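(* Let $n\ge 2$, let $S\subset\mathbb{R}^{n+1}$ be a smooth hypersurface, $y\in S$, and suppose that near $y$ the surface $S$ is the graph $\{(x,g(x))\}$ of a function $g$ of the first $n$ variables, with $(z,g(z))=y$. Put $H(x)=g(x+z)-g(z)-\nabla g(z)\cdot x$. Suppose that $g$ is real-analytic, that $N(H)$ is nonempty, that $y\notin T_y(S)$, and that the smooth cutoff function $\phi$ is nonnegative with $\phi(y)\neq 0$. Let $m$ denote the maximum order of any zero of any $H_F(x)$ ($F$ a compact face of $N(H)$) on $(\mathbb{R}-\{0\})^n$ and suppose $m>\max(d(H),2)$. Suppose there is a sequence $a^k=(a^k_1,\dots,a^k_n)$ of points in $(\mathbb{R}-\{0\})^n$ with $a^k\to 0$ such that for each $k$ there is an index $i$ for which, on a neighborhood of $a^k$, the function $H$ is of the form $$H(x)=\xi_k(x)\,\bigl(x_i-b_k(x_1,\dots,x_{i-1},x_{i+1},\dots,x_n)\bigr)^m$$ for some real-analytic $b_k$ and $\xi_k$ with $\xi_k(a^k)\neq 0$ and $b_k(a^k_1,\dots,a^k_{i-1},a^k_{i+1},\dots,a^k_n)=a^k_i$. Then the maximal operator $Mf(x)=\sup_{t>0}\left|\int_S f(x-ts)\phi(s)\,d\sigma(s)\right|$ is unbounded on $L^p$ for all $p\le m$.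
   Context: $\sigma$ is the standard surface measure on $S$. $M$ is defined initially on Schwartz functions on $\mathbb{R}^{n+1}$; ''bounded on $L^p$'' means $\|Mf\|_{L^p(\mathbb{R}^{n+1})}\le C\|f\|_{L^p(\mathbb{R}^{n+1})}$ for a constant $C$ independent of $f$. Throughout the paper $p>2$ is assumed. The coordinates are assumed to be such that $(0,\dots,0,1)$ is not in the tangent space of $S$ at $y$ (so the graph representation exists); cutoff functions $\phi$ are smooth and compactly supported near $y$, within the region where $S$ is the graph of $g$. In the condition $y\notin T_y(S)$, $T_y(S)$ is the tangent space viewed as a linear subspace of $\mathbb{R}^{n+1}$; equivalently, the affine hyperplane tangent to $S$ at $y$ does not contain the origin. Newton polyhedron: let $f$ be smooth near the origin of $\mathbb{R}^n$ with Taylor expansion $\sum_\alpha f_\alpha x^\alpha$ at the origin. For each $\alpha$ with $f_\alpha\neq 0$ let $Q_\alpha=\{x\in\mathbb{R}^n: x_i\ge\alpha_i\text{ for all }i\}$. The Newton polyhedron $N(f)$ is the convex hull of the union of all these $Q_\alpha$. When $N(f)$ is nonempty, the Newton distance is $d(f)=\inf\{t:(t,\dots,t)\in N(f)\}$. For a compact face $F$ of $N(f)$ (a vertex is considered a compact face of dimension $0$), $f_F(x)=\sum_{\alpha\in F}f_\alpha x^\alpha$. The order of a zero of $f_F$ at a point is the smallest $|\alpha|$ such that $\partial^\alpha f_F$ is nonzero at that point. *)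

(* Defs.v *)
From HB Require Import structures.
From mathcomp Require Import all_boot all_order all_algebra.
From mathcomp Require Import all_classical all_reals all_analysis measurable_realfun.
Set Implicit Arguments.
Unset Strict Implicit.
Unset Printing Implicit Defensive.
Import Order.TTheory GRing.Theory Num.Theory.
Import numFieldNormedType.Exports.
Local Open Scope classical_set_scope.
Local Open Scope ring_scope.

Section smooth_functions.
Context (R : realType) (n : nat).
Implicit Types (f g : 'rV[R]_n -> R) (x a u v : 'rV[R]_n) (A V : set 'rV[R]_n).

Definition dot u v : R := \sum_i u 0 i * v 0 i.

Definition partial (i : 'I_n) f : 'rV[R]_n -> R :=
  fun x => 'D_(delta_mx 0 i) f x.

Definition partials (s : seq 'I_n) f : 'rV[R]_n -> R := foldr partial f s.

Definition gradient f x : 'rV[R]_n := \row_i partial i f x.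

(* [A] is meant to be open. *)
Definition smooth_on A f : Prop := forall (s : seq 'I_n) x, A x ->
  {for x, continuous (partials s f)} /\
  forall i, derivable (partials s f) x (delta_mx 0 i).

Definition multi_index := {ffun 'I_n -> nat}.
Implicit Type al : multi_index.

Definition mi_deg al : nat := (\sum_i al i)%N.

Definition mi_fact al : nat := (\prod_i (al i)`!)%N.

Definition monomial al x : R := \prod_i x 0 i ^+ al i.

Definition mderiv al f : 'rV[R]_n -> R :=
  partials (flatten [seq nseq (al i) i | i <- enum 'I_n]) f.

Definition analytic_at f a : Prop :=
  exists (c : multi_index -> R) (r : R), 0 < r /\ forall x, ball a r x ->
    summable [set: multi_index] (fun al => (c al * monomial al (x - a))%:E) /\
    \sum_(al \in [set al | (mi_deg al < N)%N]) c al * monomial al (x - a)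
      @[N --> \oo] --> f x.

Definition analytic_on A f : Prop := forall a, A a -> analytic_at f a.

Definition schwartz f : Prop := smooth_on setT f /\
  forall al be : multi_index,
    exists C : R, forall x, `|monomial be x * mderiv al f x| <= C.

Definition taylor_coef f al : R := mderiv al f 0 / (mi_fact al)%:R.

Definition orthant al : set 'rV[R]_n := [set x | forall i, (al i)%:R <= x 0 i].

Definition convex_hull A : set 'rV[R]_n :=
  smallest (@convex_set R 'rV[R]_n) A.

Definition newton_polyhedron f : set 'rV[R]_n :=
  convex_hull (\bigcup_(al in [set al | taylor_coef f al != 0]) orthant al).

Definition newton_distance f : R :=
  inf [set t : R | newton_polyhedron f (const_mx t)].

(* Faces are cut out by supporting hyperplanes; [w = 0] gives the improper face
   [A] itself, which for [n > 0] is not compact when [A] is a nonempty Newton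
   polyhedron. *)
Definition face A (F : set 'rV[R]_n) : Prop := F !=set0 /\
  exists (w : 'rV[R]_n) (c : R),
    (forall x, A x -> c <= dot w x) /\ F = A `&` [set x | dot w x = c].

Definition compact_face A (F : set 'rV[R]_n) : Prop := face A F /\ compact F.

(* The sum has finite support as soon as [F] is bounded. *)
Definition face_poly f (F : set 'rV[R]_n) : 'rV[R]_n -> R := fun x =>
  \sum_(al \in [set al : multi_index | F (\row_i (al i)%:R)])
    taylor_coef f al * monomial al x.

Definition zero_order f x (k : nat) : Prop := [/\ f x = 0,
  exists2 al : multi_index, mi_deg al = k & mderiv al f x != 0 &
  forall al : multi_index, (mi_deg al < k)%N -> mderiv al f x = 0].

Definition off_axes x : Prop := forall i, x 0 i != 0.

Definition face_zero_order f (k : nat) : Prop := exists F x,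
  [/\ compact_face (newton_polyhedron f) F, off_axes x &
      zero_order (face_poly f F) x k].

Definition max_face_zero_order f (m : nat) : Prop :=
  face_zero_order f m /\ forall k, face_zero_order f k -> (k <= m)%N.

End smooth_functions.

Definition snoc (R : realType) (n : nat) (x : 'rV[R]_n) (r : R) : 'rV[R]_n.+1 :=
  \row_j if unlift ord_max j is Some i then x 0 i else r.

Definition rV_display : measure_display.
Proof. exact: default_measure_display. Qed.

Section borel_rV.
Context (R : realType) (n : nat).

Let borel : set_system 'rV[R]_n := <<s [set A : set 'rV[R]_n | open A] >>.

Let borel0 : borel set0.
Proof. exact: sigma_algebra0. Qed.

Let borelC A : borel A -> borel (~` A).
Proof. exact: sigma_algebraC. Qed.

Let borel_bigcup (F : (set 'rV[R]_n)^nat) :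
  (forall i, borel (F i)) -> borel (\bigcup_i F i).
Proof. exact: sigma_algebra_bigcup. Qed.

HB.instance Definition _ := @isMeasurable.Build rV_display 'rV[R]_n
  borel borel0 borelC borel_bigcup.

End borel_rV.

Lemma open_rV_measurable (R : realType) (n : nat) (A : set 'rV[R]_n) :
  open A -> measurable A.
Proof. by move=> oA; exact: sub_sigma_algebra. Qed.

Lemma continuous_rV_measurable (R : realType) (n : nat) (f : 'rV[R]_n -> R) :
  continuous f -> measurable_fun setT (f : 'rV[R]_n -> measurableTypeR R).
Proof.
move=> /continuousP cf.
apply: (measurability _ (RGenOpens.measurableE R)).
move=> _ [_ [a [b ->] <-]]; rewrite setTI; apply: open_rV_measurable.
exact/cf/interval_open.
Qed.

Lemma open_rV_rat (R : realType) (n : nat) (A : set 'rV[R]_n) : open A ->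
  A = \bigcup_(q in [set q : 'rV[rat]_n * nat |
        ball (map_mx ratr q.1 : 'rV[R]_n) q.2.+1%:R^-1 `<=` A])
      ball (map_mx ratr q.1 : 'rV[R]_n) q.2.+1%:R^-1.
Proof.
move=> oA; apply/seteqP; split; last by move=> x [q qA qx]; exact: qA.
move=> x Ax; have /nbhs_ballP[e /= e0 eA] := open_nbhs_nbhs (conj oA Ax).
have e20 : 0 < e / 2 by rewrite divr_gt0.
have [k ke] : exists k : nat, k.+1%:R^-1 < e / 2 :> R.
  have [N _ Ne] := near_infty_natSinv_lt (PosNum e20).
  by exists N; exact: (Ne N (leqnn N)).
have k0 : 0 < k.+1%:R^-1 :> R by rewrite invr_gt0.
have qx i : {q : rat | `|x 0 i - ratr q| < k.+1%:R^-1}.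
  apply: cid; have [|q qxi] := @rat_in_itvoo R (x 0 i - k.+1%:R^-1) (x 0 i + k.+1%:R^-1).
    by rewrite ltrD2l (lt_trans _ k0)// oppr_lt0.
  by exists q; rewrite distrC ltr_distl; rewrite in_itv/= in qxi.
have xq : ball (map_mx ratr (\row_i sval (qx i)) : 'rV[R]_n) k.+1%:R^-1 x.
  split=> // i j; rewrite !mxE ord1; case: (qx j) => q /= qxj.
  by rewrite /ball /= distrC.
exists (\row_i sval (qx i), k) => //= w qw.
apply: eA; apply: (@le_ball _ _ _ (k.+1%:R^-1 + k.+1%:R^-1)).
  by rewrite [leRHS]splitr lerD// ltW.
by apply: ball_triangle qw; exact: ball_sym.
Qed.

Lemma measurable_fun_rV d (T : measurableType d) (R : realType) (n : nat)
    (F : T -> 'rV[R]_n) :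
  (forall i, measurable_fun setT ((fun t => F t 0 i) : T -> measurableTypeR R)) ->
  measurable_fun setT F.
Proof.
move=> mF; apply: (measurability [set A : set 'rV[R]_n | open A]) => //.
move=> _ [A oA <-]; rewrite setTI (open_rV_rat oA) preimage_bigcup.
rewrite bigcup_mkcond; apply: countable_bigcupT_measurable; first exact: countableP.
move=> q; case: ifP => // _.
rewrite (_ : _ @^-1` _ = \bigcap_(i in [set: 'I_n])
    ((fun t => F t 0 i) @^-1` ball (ratr (q.1 0 i) : R) q.2.+1%:R^-1)); last first.
  apply/seteqP; split=> t /=.
    by move=> [_ Ft] i _; have := Ft 0 i; rewrite mxE.
  move=> Ft; split; first by rewrite invr_gt0.
  by move=> i j; rewrite mxE ord1; exact: Ft.
apply: fin_bigcap_measurable => // i _.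
rewrite -[X in measurable X]setTI; apply: (mF i) => //.
exact: measurable_ball.
Qed.

Lemma snoc_lift (R : realType) (n : nat) (x : 'rV[R]_n) (r : R) i :
  snoc x r 0 (lift ord_max i) = x 0 i.
Proof. by rewrite mxE liftK. Qed.

Lemma snoc_max (R : realType) (n : nat) (x : 'rV[R]_n) (r : R) :
  snoc x r 0 ord_max = r.
Proof. by rewrite mxE unlift_none. Qed.

Definition snocp (R : realType) (n : nat) (p : 'rV[R]_n * measurableTypeR R) :
  'rV[R]_n.+1 := snoc p.1 p.2.

Lemma measurable_snocp (R : realType) (n : nat) :
  measurable_fun setT (@snocp R n).
Proof.
apply: measurable_fun_rV => j; have [i ->|->] := unliftP ord_max j.
  rewrite (_ : (fun _ => _) = (fun x : 'rV[R]_n => x 0 i) \o fst); last first.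
    by apply/funext => p; exact: snoc_lift.
  apply: measurableT_comp; last exact: measurable_fst.
  by apply: continuous_rV_measurable => x; exact: coord_continuous.
rewrite (_ : (fun _ => _) = snd); first exact: measurable_snd.
by apply/funext => p; exact: snoc_max.
Qed.

Section lebesgue_step.
Context (R : realType) (n : nat).
Variable mu : {sigma_finite_measure set 'rV[R]_n -> \bar R}.

Definition lebesgue_step : set 'rV[R]_n.+1 -> \bar R :=
  pushforward (mu \x @lebesgue_measure R)%E (@snocp R n).

Let mS : measurable_fun setT (@snocp R n) := @measurable_snocp R n.

Let lebesgue_step0 : lebesgue_step set0 = 0%E.
Proof. exact: measure0. Qed.

Let lebesgue_step_ge0 A : (0 <= lebesgue_step A)%E.
Proof. exact: measure_ge0. Qed.

Let lebesgue_step_sigma_additive : semi_sigma_additive lebesgue_step.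
Proof. exact: measure_semi_sigma_additive. Qed.

HB.instance Definition _ := isMeasure.Build _ _ _ lebesgue_step
  lebesgue_step0 lebesgue_step_ge0 lebesgue_step_sigma_additive.

Let lebesgue_step_sigma_finite : sigma_finite setT lebesgue_step.
Proof.
have /sigma_finiteP[F [TF ndF Foo]] := sigma_finiteT mu.
have /sigma_finiteP[G [TG ndG Goo]] := sigma_finiteT (@lebesgue_measure R).
pose U (x : 'rV[R]_n.+1) : 'rV[R]_n * measurableTypeR R :=
  (\row_i x 0 (lift ord_max i), x 0 ord_max).
have mU : measurable_fun setT U.
  apply/measurable_fun_pairP; split.
    apply: measurable_fun_rV => i; apply: continuous_rV_measurable => x /=.
    rewrite (_ : (fun _ => _) = (fun y : 'rV[R]_n.+1 => y 0 (lift ord_max i))).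
      exact: coord_continuous.
    by apply/funext => y; rewrite !mxE.
  by apply: continuous_rV_measurable => x /=; exact: coord_continuous.
have snocpK p : U (snocp p) = p.
  case: p => x r; congr pair; last exact: snoc_max.
  by apply/rowP => i; rewrite mxE snoc_lift.
exists (fun k => U @^-1` (F k `*` G k)).
  apply/seteqP; split=> // x _.
  have [i _ Fi] : (\bigcup_k F k) (U x).1 by rewrite -TF.
  have [j _ Gj] : (\bigcup_k G k) (U x).2 by rewrite -TG.
  exists (maxn i j) => //; split.
    by move: Fi; exact/subsetPset/ndF/leq_maxl.
  by move: Gj; exact/subsetPset/ndG/leq_maxr.
move=> k; have [mF Fk] := Foo k; have [mG Gk] := Goo k; split.
  by rewrite -[X in measurable X]setTI; apply: mU => //; exact: measurableX.
rewrite /lebesgue_step /pushforward -comp_preimage.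
rewrite (_ : U \o _ = id); last by apply/funext => p; exact: snocpK.
by rewrite preimage_id product_measure1E// lte_mul_pinfty// ge0_fin_numE.
Qed.

HB.instance Definition _ := Measure_isSigmaFinite.Build _ _ _ lebesgue_step
  lebesgue_step_sigma_finite.

End lebesgue_step.

Fixpoint lebesgue_rV (R : realType) (n : nat) :
    {sigma_finite_measure set 'rV[R]_n -> \bar R} :=
  if n is k.+1 then lebesgue_step (lebesgue_rV R k) else \d_(0 : 'rV[R]_0).

Section hypersurfaces.
Context (R : realType) (n : nat).
Implicit Types (S U : set 'rV[R]_n.+1) (V W : set 'rV[R]_n).

Definition smooth_hypersurface S : Prop := forall y, S y ->
  exists (U : set 'rV[R]_n.+1) (F : 'rV[R]_n.+1 -> R),
    [/\ open U, U y, smooth_on U F,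
        S `&` U = [set x | F x = 0] `&` U &
        forall x, (S `&` U) x -> gradient F x != 0].

(* Velocities of curves in [S]; on an embedded hypersurface, requiring the curve
   to be differentiable at [0] only, rather than smooth, gives the same space. *)
Definition tangent_space S (y : 'rV[R]_n.+1) : set 'rV[R]_n.+1 :=
  [set v | exists gamma : R -> 'rV[R]_n.+1,
    [/\ gamma 0 = y, \forall t \near (0 : R), S (gamma t) &
        is_derive (0 : R) (1 : R) gamma v]].

Definition graph_pt (g : 'rV[R]_n -> R) (x : 'rV[R]_n) : 'rV[R]_n.+1 :=
  snoc x (g x).

(* Row [i] is the [i]-th partial derivative of [psi]. *)
Definition jacobian_rows (psi : 'rV[R]_n -> 'rV[R]_n.+1) (u : 'rV[R]_n) :
    'M[R]_(n, n.+1) :=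
  \matrix_(i, j) partial i (fun w => psi w 0 j) u.

Definition area_element (psi : 'rV[R]_n -> 'rV[R]_n.+1) (u : 'rV[R]_n) : R :=
  Num.sqrt (\det (jacobian_rows psi u *m (jacobian_rows psi u)^T)).

Definition local_parametrization S W U
    (psi : 'rV[R]_n -> 'rV[R]_n.+1) : Prop :=
  [/\ open W, open U, forall j, smooth_on W (fun u => psi u 0 j),
      forall u, W u -> row_free (jacobian_rows psi u) &
      set_bij W (S `&` U) psi].

(* This determines [sigma]: countably many parametrized pieces cover [S]. *)
Definition surface_measure S
    (sigma : {measure set 'rV[R]_n.+1 -> \bar R}) : Prop :=
  sigma (~` S) = 0%E /\
  forall W U psi, local_parametrization S W U psi ->
  forall f : 'rV[R]_n.+1 -> \bar R,
    measurable_fun setT f -> (forall x, 0 <= f x)%E ->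
    (\int[sigma]_(x in S `&` U) f x =
     \int[lebesgue_rV R n]_(u in W) (f (psi u) * (area_element psi u)%:E))%E.

Definition maximal_operator S (sigma : {measure set 'rV[R]_n.+1 -> \bar R})
    (phi f : 'rV[R]_n.+1 -> R) : 'rV[R]_n.+1 -> \bar R := fun x =>
  ereal_sup [set `|\int[sigma]_(s in S) (f (x - t *: s) * phi s)%:E|%E
            | t in [set t : R | 0 < t]].

Definition bounded_on_Lp (p : R)
    (M : ('rV[R]_n.+1 -> R) -> 'rV[R]_n.+1 -> \bar R) : Prop :=
  exists C : R, forall f, schwartz f ->
    ('N[lebesgue_rV R n.+1]_p%:E[M f] <=
     C%:E * 'N[lebesgue_rV R n.+1]_p%:E[EFin \o f])%E.

End hypersurfaces.

(* Main.v *)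
From HB Require Import structures.
Require Import Defs.
From mathcomp Require Import all_boot all_order all_algebra finmap.
From mathcomp Require Import all_classical all_reals all_analysis measurable_realfun.
From mathcomp Require Import ring lra zify.
Set Implicit Arguments.
Unset Strict Implicit.
Unset Printing Implicit Defensive.
Import Order.TTheory GRing.Theory Num.Theory.
Import numFieldNormedType.Exports.
Local Open Scope classical_set_scope.
Local Open Scope ring_scope.

(* The tangent plane P of S at y, with normal nu = (- grad g(z), 1), misses the
   origin, so for x near y the dilate of S about x by t = <x, nu> / <y, nu> is
   tangent to the hyperplane <., nu> = 0, and along it <x - t s, nu> = - t H.
   Near a^k one has |H| <= C |x_i - b|^m, so {|H| <= C 2^(-j m)} has measure at
   least c 2^(-j).  Superposing N Gaussian slabs of height 2^j and width
   2^(-j p) around <., nu> = 0 therefore makes M f >= c N on a fixed ball when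
   p <= m, whereas the p-th power of the L^p norm of f is only O(N). *)

(** A single slab cannot reach the endpoint: its L^p norm is O(1), and the bound it gives for M f is
    of order 2^j * 2^(-j p / m), which stays bounded at p = m. The gain comes from superposition.
    The dilation t depends on x alone, so one t serves all N scales and their contributions to M f
    add up to c N. In L^p the heights 2^j are lacunary, so the slabs, though nested, behave as if
    disjoint and f has norm O(N^(1/p)). As p > 1, letting N grow excludes every constant.

    The slabs are Gaussian because boundedness is tested on Schwartz functions only. Measurability
    of M f is never established: lower bounds for its norm come from monotonicity of the integral as
    a supremum over simple functions. Analyticity of [g], [xi] and [b] is given by convergent power
    series, so the differentiability and continuity drawn from it are first derived from absolute
    summability. *)

(** * Integration on row vectors *)

(* [ge0_le_integral] without measurability: the integral of a nonnegative
   function is a supremum over the simple functions below it. *)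
Lemma ge0_le_integral_nonmeasurable d (T : measurableType d) (R : realType)
    (mu : {measure set T -> \bar R}) (D : set T) (f1 f2 : T -> \bar R) :
  (forall x, D x -> (0 <= f1 x)%E) -> (forall x, D x -> (f1 x <= f2 x)%E) ->
  (\int[mu]_(x in D) f1 x <= \int[mu]_(x in D) f2 x)%E.
Proof.
move=> f10 f12.
have f20 x : D x -> (0 <= f2 x)%E.
  by move=> Dx; exact: le_trans (f10 _ Dx) (f12 _ Dx).
rewrite !ge0_integralE//.
apply: le_ereal_sup => _ [h hf <-]; exists h => //= x.
by apply: (le_trans (hf x)); apply: lee_restrict.
Qed.

Section lebesgue_rV_theory.
Context (R : realType).

Lemma lebesgue_measure_shift (c : R) (A : set (measurableTypeR R)) :
  measurable A ->
  lebesgue_measure ((fun x : R => x + c) @^-1` A) = lebesgue_measure A.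
Proof.
move=> mA.
have mc : measurable_fun setT
    ((fun x : R => x + c) : measurableTypeR R -> measurableTypeR R).
  exact: measurable_funD.
pose mc_mixin := isMeasurableFun.Build _ _ _ _ _ mc.
pose F : {mfun (measurableTypeR R) >-> (measurableTypeR R)} := HB.pack
  ((fun x : R => x + c) : measurableTypeR R -> measurableTypeR R) mc_mixin.
rewrite [RHS](@lebesgue_measure_unique R (pushforward lebesgue_measure F))//.
move=> X [[a b]] /= _ <-.
rewrite /pushforward.
have -> : F @^-1` `]a, b] = `]a - c, b - c]%classic.
  by apply/seteqP; split=> x /=; rewrite !in_itv/= lerBrDr ltrBlDr.
rewrite !lebesgue_measure_itv/= !lte_fin ltrD2r; case: ifP => // _.
by rewrite -!EFinB; congr (_%:E); ring.
Qed.

Lemma measurable_fun_rV_of_continuous (n k : nat) (F : 'rV[R]_n -> 'rV[R]_k) :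
  (forall i, continuous (fun x => F x 0 i)) -> measurable_fun setT F.
Proof.
by move=> cF; apply: measurable_fun_rV => i; exact: continuous_rV_measurable.
Qed.

Lemma measurable_fun_rV_shift (n : nat) (v : 'rV[R]_n) :
  measurable_fun setT (fun x : 'rV[R]_n => x + v).
Proof.
apply: measurable_fun_rV_of_continuous => i x.
rewrite (_ : (fun _ => _) = (fun y : 'rV[R]_n => y 0 i + v 0 i)); last first.
  by apply/funext => y; rewrite mxE.
by apply: continuousD; [exact: coord_continuous|exact: cst_continuous].
Qed.

(** The measure is built one coordinate at a time: invariance on the line moves each section in the
    last coordinate, and the induction hypothesis says that pushing the measure forward along the
    remaining shift changes nothing in the outer integral. *)
Lemma lebesgue_rV_shift (n : nat) (v : 'rV[R]_n) (A : set 'rV[R]_n) :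
  measurable A ->
  lebesgue_rV R n ((fun x => x + v) @^-1` A) = lebesgue_rV R n A.
Proof.
elim: n v A => [v A mA|n IH v A mA].
  rewrite (_ : _ @^-1` A = A)//.
  by apply/seteqP; split=> x; rewrite /= (thinmx0 v) addr0.
pose v1 : 'rV[R]_n := \row_i v 0 (lift ord_max i); pose c := v 0 ord_max.
pose F : 'rV[R]_n -> 'rV[R]_n := fun x => x + v1.
have mF : measurable_fun setT F by exact: measurable_fun_rV_shift.
pose mF_mixin := isMeasurableFun.Build _ _ _ _ _ mF.
pose F' : {mfun 'rV[R]_n >-> 'rV[R]_n} := HB.pack F mF_mixin.
have mS A' : measurable A' -> measurable (@snocp R n @^-1` A').
  by move=> mA'; rewrite -[X in measurable X]setTI; exact: measurable_snocp.
have snocD x t : snoc x t + v = snoc (F x) (t + c).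
  apply/rowP => j; rewrite mxE; have [i ->|->] := unliftP ord_max j.
    by rewrite !snoc_lift !mxE.
  by rewrite !snoc_max.
rewrite /= /lebesgue_step /pushforward /= /product_measure1 /=.
set B := @snocp R n @^-1` A.
transitivity (\int[lebesgue_rV R n]_x (lebesgue_measure \o xsection B) (F x))%E.
  apply: eq_integral => x _ /=.
  rewrite -[RHS](lebesgue_measure_shift c); last first.
    by apply: measurable_xsection; exact: mS.
  congr (lebesgue_measure _); apply/seteqP; split => t;
    by rewrite /xsection /= !inE /snocp/= snocD.
transitivity (\int[pushforward (lebesgue_rV R n) F']_x (lebesgue_measure \o xsection B) x)%E.
  rewrite ge0_integral_pushforward//.
  by apply: measurable_fun_xsection; exact: mS.
by apply: eq_measure_integral => C mC _; exact: IH.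
Qed.

(** Row vectors carry the sup norm, so a ball is a cube of side 2 r. *)
Lemma lebesgue_rV_ball (n : nat) (a : 'rV[R]_n) (r : R) : 0 < r ->
  lebesgue_rV R n (ball a r) = ((r *+ 2) ^+ n)%:E.
Proof.
move=> r0; elim: n a => [a|n IH a].
  rewrite expr0 /= diracE mem_set//.
  by split => // i [].
rewrite /= /lebesgue_step /pushforward.
pose a1 : 'rV[R]_n := \row_i a 0 (lift ord_max i); pose a2 : R := a 0 ord_max.
transitivity ((lebesgue_rV R n \x @lebesgue_measure R)%E (ball a1 r `*` ball a2 r)).
  congr (_ _); apply/seteqP; split => -[x t] /=.
    move=> [_ H]; split.
      split => // i j; rewrite !ord1 mxE; have := H 0 (lift ord_max j).
      by rewrite /snocp snoc_lift.
    by have := H 0 ord_max; rewrite /snocp snoc_max.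
  move=> [[_ H1] H2]; split => // i j; rewrite ord1 /snocp/=.
  have [k ->|->] := unliftP ord_max j.
    by rewrite snoc_lift; have := H1 0 k; rewrite mxE.
  by rewrite snoc_max.
transitivity (lebesgue_rV R n (ball a1 r) * (@lebesgue_measure R (ball a2 r)))%E.
  apply: product_measure1E; last exact: measurable_ball.
  by apply: open_rV_measurable; exact: ball_open.
by rewrite IH lebesgue_measure_ball ?ltW// exprSr EFinM.
Qed.

Lemma ge0_integral_lebesgue_rVS (n : nat) (f : 'rV[R]_n.+1 -> \bar R) :
  measurable_fun setT f -> (forall x, (0 <= f x)%E) ->
  (\int[lebesgue_rV R n.+1]_x f x =
   \int[lebesgue_rV R n]_x \int[lebesgue_measure]_t f (snoc x t))%E.
Proof.
move=> mf f0; rewrite /= /lebesgue_step.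
rewrite [LHS](ge0_integral_pushforward (@measurable_snocp R n))//.
rewrite preimage_setT fubini_tonelli1//=.
by apply: measurableT_comp => //; exact: measurable_snocp.
Qed.


End lebesgue_rV_theory.

(** * Gaussian test functions *)

(** Reduces a directional derivative to one real variable, where instance resolution for [is_derive]
    can compute it. *)
Lemma is_derive_line (R : realType) (V W : normedModType R) (f : V -> W) x v df :
  is_derive (0 : R) (1 : R) (fun h : R => f (h *: v + x)) df -> is_derive x v f df.
Proof.
move=> [fd <-]; apply: DeriveDef; first exact: (derivable1P f x v).2.
rewrite /derive; set g1 := fun h => h^-1 *: _; set g2 := fun h => h^-1 *: _.
suff -> : g1 = g2 by [].
by apply/funext => h; rewrite /g1 /g2 /= addr0 scale0r add0r [_%:A]mulr1.
Qed.

Section gaussians.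
Context (R : realType) (n : nat).
Implicit Types (u v x nu : 'rV[R]_n) (f g : 'rV[R]_n -> R).

Lemma dotDr u v w : dot u (v + w) = dot u v + dot u w.
Proof. by rewrite -big_split; apply: eq_bigr => i _; rewrite mxE mulrDr. Qed.

Lemma dotZr (a : R) u v : dot u (a *: v) = a * dot u v.
Proof. by rewrite mulr_sumr; apply: eq_bigr => i _; rewrite mxE mulrCA. Qed.

Lemma dotC u v : dot u v = dot v u.
Proof. by apply: eq_bigr => i _; rewrite mulrC. Qed.

Lemma dotNr u v : dot u (- v) = - dot u v.
Proof. by rewrite -scaleN1r dotZr mulN1r. Qed.

Lemma dotBr u v w : dot u (v - w) = dot u v - dot u w.
Proof. by rewrite dotDr dotNr. Qed.

Lemma dot_ge0 u : 0 <= dot u u.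
Proof. by apply: sumr_ge0 => i _; rewrite -expr2 sqr_ge0. Qed.

Lemma dot_delta u i : dot u (delta_mx 0 i) = u 0 i.
Proof.
rewrite /dot (bigD1 i)//= big1 ?addr0; first by rewrite mxE !eqxx mulr1.
by move=> j ji; rewrite mxE (negbTE ji) andbF mulr0.
Qed.

Lemma continuous_dot u : continuous (dot u).
Proof.
apply: continuous_big => [|i _]; first exact: add_continuous.
move=> x; apply: continuousM; first exact: cst_continuous.
exact: coord_continuous.
Qed.

Lemma continuous_dotxx : continuous (fun x => dot x x).
Proof.
apply: continuous_big => [|i _]; first exact: add_continuous.
by move=> x; apply: continuousM; exact: coord_continuous.
Qed.

(** A smooth slab around the hyperplane orthogonal to [nu], of thickness of order 1 / sqrt c; the
    term [dot x x] makes it decay along the hyperplane as well. *)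
Definition gaussian nu (c : R) x := expR (- (dot x x + c * dot nu x ^+ 2)).

Lemma continuous_gaussian nu c : continuous (gaussian nu c).
Proof.
move=> x; apply: (@continuous_comp _ _ _ (fun x => - (dot x x + c * dot nu x ^+ 2)) expR);
  last exact: continuous_expR.
apply: continuousN; apply: continuousD; first exact: continuous_dotxx.
apply: continuousM; first exact: cst_continuous.
apply: (@continuous_comp _ _ _ (dot nu) (fun t => t ^+ 2)); first exact: continuous_dot.
exact: exprn_continuous.
Qed.

Lemma is_derive_gaussian nu c x v : is_derive x v (gaussian nu c)
  (- (2 * dot v x + 2 * c * dot nu v * dot nu x) * gaussian nu c x).
Proof.
apply: is_derive_line.
pose q (h : R) : R := - (dot x x + 2 * dot v x * h + dot v v * h ^+ 2 +
  c * (dot nu x + dot nu v * h) ^+ 2).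
rewrite (_ : (fun h => _) = expR \o q); last first.
  apply/funext => h; rewrite /gaussian /q /=; congr (expR (- _)).
  rewrite !dotDr !dotZr ![dot (_ + _) _]dotC !dotDr !dotZr (dotC x v); ring.
rewrite (_ : gaussian nu c x = expR (q 0)); last first.
  by rewrite /gaussian /q; congr (expR _); ring.
have hq : is_derive (0 : R) (1 : R) q
    (- (2 * dot v x + 2 * c * dot nu v * dot nu x)).
  apply: is_derive_eq; rewrite /GRing.scale /=.
  by ring.
by apply: is_derive_eq; rewrite mulrC.
Qed.

End gaussians.

(** * The Gaussian slabs are Schwartz functions *)

Section gaussian_span.
Context (R : realType) (n : nat) (nu : 'rV[R]_n).

(* The span of [x ^ al * exp (- |x|^2 - c <nu, x>^2)], stable under partial
   derivatives. *)
Inductive gaussian_span : ('rV[R]_n -> R) -> Prop :=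
| gaussian_span_gaussian c : 0 <= c -> gaussian_span (gaussian nu c)
| gaussian_spanD f g : gaussian_span f -> gaussian_span g ->
    gaussian_span (fun x => f x + g x)
| gaussian_spanZ a f : gaussian_span f -> gaussian_span (fun x => a * f x)
| gaussian_spanX i f : gaussian_span f -> gaussian_span (fun x => x 0 i * f x).

Lemma gaussian_span_sum (I : Type) (s : seq I) (F : I -> 'rV[R]_n -> R) f :
  gaussian_span f -> (forall i, gaussian_span (F i)) ->
  gaussian_span (fun x => \sum_(i <- s) F i x).
Proof.
move=> sf sF; elim: s => [|i s IH].
  (* The span has no constructor for the zero function; [0 * f] supplies the empty sum, which is why
     a member [f] is assumed. *)
  rewrite (_ : (fun _ => _) = (fun x => 0 * f x)); first exact: gaussian_spanZ.
  by apply/funext => x; rewrite big_nil mul0r.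
rewrite (_ : (fun _ => _) = (fun x => F i x + \sum_(i <- s) F i x)).
  exact: gaussian_spanD.
by apply/funext => x; rewrite big_cons.
Qed.

Lemma gaussian_span_continuous f : gaussian_span f -> continuous f.
Proof.
elim=> {f} [c c0|f g _ cf _ cg|a f _ cf|i f _ cf] x.
- exact: continuous_gaussian.
- exact: continuousD (cf x) (cg x).
- apply: continuousM; [exact: cst_continuous|exact: cf].
- apply: continuousM; [exact: coord_continuous|exact: cf].
Qed.

Lemma is_derive_coord (i : 'I_n) (x v : 'rV[R]_n) :
  is_derive x v (fun y : 'rV[R]_n => y 0 i) (v 0 i).
Proof.
apply: is_derive_line.
rewrite (_ : (fun _ => _) = (fun h : R => h * v 0 i + x 0 i)).
  by apply: is_derive_eq; rewrite /GRing.scale/=; ring.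
by apply/funext => h; rewrite !mxE.
Qed.

Lemma gaussian_span_derive (i : 'I_n) f : gaussian_span f ->
  exists2 g, gaussian_span g & forall x, is_derive x (delta_mx 0 i) f (g x).
Proof.
elim=> {f} [c c0|f g sf [f' sf' df] sg [g' sg' dg]|a f sf [f' sf' df]|j f sf [f' sf' df]].
- eexists; last by move=> x; exact: is_derive_gaussian.
  have sg := gaussian_span_gaussian c0.
  rewrite (_ : (fun _ => _) = (fun x : 'rV[R]_n => (- 2) * (x 0 i * gaussian nu c x) +
      (- (2 * c * nu 0 i)) * \sum_j nu 0 j * (x 0 j * gaussian nu c x))).
    apply: gaussian_spanD; first exact/gaussian_spanZ/gaussian_spanX.
    apply: gaussian_spanZ; apply: gaussian_span_sum; first exact: sg.
    by move=> j; exact/gaussian_spanZ/gaussian_spanX.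
  apply/funext => x; rewrite (dotC (delta_mx 0 i)) !dot_delta.
  under eq_bigr do rewrite mulrA.
  rewrite -mulr_suml -/(dot nu x).
  by ring.
- exists (fun x => f' x + g' x); first exact: gaussian_spanD.
  by move=> x; exact: is_deriveD.
- exists (fun x => a * f' x); first exact: gaussian_spanZ.
  move=> x; apply: (is_derive_eq (is_deriveM (is_derive_cst a x _) (df x))).
  by rewrite /GRing.scale/= mulr0 addr0.
- exists (fun x : 'rV[R]_n => x 0 j * f' x + (delta_mx 0 i : 'rV[R]_n) 0 j * f x).
    by apply: gaussian_spanD; [exact: gaussian_spanX|exact: gaussian_spanZ].
  move=> x; apply: (is_derive_eq (is_deriveM (is_derive_coord j x _) (df x))).
  by rewrite /GRing.scale/= [X in _ + X]mulrC.
Qed.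

Lemma gaussian_span_partials s f : gaussian_span f -> gaussian_span (partials s f).
Proof.
elim: s => //= i s IH sf; have [g sg dg] := gaussian_span_derive i (IH sf).
rewrite (_ : partial i _ = g) //; apply/funext => x.
by rewrite /partial; exact: derive_val.
Qed.

Lemma gaussian_span_smooth f : gaussian_span f -> smooth_on setT f.
Proof.
move=> sf s x _; have ss := gaussian_span_partials s sf; split.
  exact: gaussian_span_continuous.
by move=> i; have [g _ dg] := gaussian_span_derive i ss; exact: ex_derive.
Qed.

(** Raise 1 + t^2 <= (k+1) exp(t^2 / (k+1)) to the power k+1: the exponentials multiply to exp(t^2),
    and |t|^k is below (1 + t^2)^(k+1). Using k+1 rather than k avoids dividing by zero. *)
Lemma exprn_le_expR (k : nat) : exists C : R,
  0 <= C /\ forall t : R, `|t| ^+ k * expR (- t ^+ 2) <= C.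
Proof.
exists (k.+1%:R ^+ k.+1); split => [|t]; first exact: exprn_ge0.
rewrite expRN ler_pdivrMr ?expR_gt0//.
have t1 : `|t| <= 1 + t ^+ 2.
  by rewrite -(real_normK (num_real t)); have := sqr_ge0 (`|t| - 1); nra.
have k0 : (0 : R) < k.+1%:R by [].
have tk : 1 + t ^+ 2 <= k.+1%:R * expR (t ^+ 2 / k.+1%:R).
  have := expR_ge1Dx (t ^+ 2 / k.+1%:R).
  rewrite -(ler_pM2l k0) mulrDr mulr1 mulrCA divff ?gt_eqF// mulr1.
  by apply: le_trans; rewrite lerD2r ler1n.
apply: (@le_trans _ _ ((1 + t ^+ 2) ^+ k.+1)).
  apply: (@le_trans _ _ ((1 + t ^+ 2) ^+ k)).
    by rewrite lerXn2r// nnegrE ?addr_ge0 ?sqr_ge0.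
  by rewrite ler_weXn2l// lerDl sqr_ge0.
rewrite (_ : expR (t ^+ 2) = expR (t ^+ 2 / k.+1%:R) ^+ k.+1).
  by rewrite -exprMn lerXn2r// nnegrE ?addr_ge0 ?sqr_ge0 ?mulr_ge0 ?expR_ge0.
by rewrite -expRM_natl mulrC divfK ?gt_eqF.
Qed.

(** The multi-index stays quantified inside the induction, so that a factor [x 0 j] is absorbed by
    raising [be j] by one. For a Gaussian the slab factor is at most 1, and the rest splits into
    one-variable bounds. *)
Lemma gaussian_span_decay f : gaussian_span f -> forall be : multi_index n,
  exists C : R, forall x, `|monomial be x * f x| <= C.
Proof.
elim=> {f} [c c0|f g _ bf _ bg|a f _ bf|j f _ bf] be.
- pose C i := sval (cid (exprn_le_expR (be i))).
  have C0 i : 0 <= C i by have [] := svalP (cid (exprn_le_expR (be i))).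
  have CP i t : `|t| ^+ be i * expR (- t ^+ 2) <= C i.
    by have [_] := svalP (cid (exprn_le_expR (be i))).
  exists (\prod_i C i) => x.
  rewrite normrM (ger0_norm (expR_ge0 _)) /monomial normr_prod.
  apply: (@le_trans _ _ (\prod_i (`|x 0 i| ^+ be i * expR (- (x 0 i) ^+ 2)))).
    rewrite big_split/= -expR_sum; under eq_bigr do rewrite normrX.
    rewrite ler_wpM2l//; first by apply: prodr_ge0 => i _; exact: exprn_ge0.
    rewrite ler_expR sumrN lerN2 /dot; under eq_bigr do rewrite expr2.
    by rewrite lerDl mulr_ge0// sqr_ge0.
  apply: ler_prod => i _; rewrite CP andbT.
  by rewrite mulr_ge0 ?exprn_ge0 ?expR_ge0.
- have [C CP] := bf be; have [D DP] := bg be; exists (C + D) => x.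
  by rewrite mulrDr (le_trans (ler_normD _ _))// lerD.
- have [C CP] := bf be; exists (`|a| * C) => x.
  by rewrite mulrCA normrM ler_wpM2l.
- have [C CP] := bf [ffun i => (be i + (i == j))%N]; exists C => x.
  have := CP x; congr (`|_| <= _); rewrite mulrA; congr (_ * _).
  rewrite /monomial; under eq_bigr do rewrite ffunE exprD.
  rewrite big_split/=; congr (_ * _).
  rewrite (bigD1 j)//= big1 ?mulr1 ?eqxx ?expr1// => i /negbTE ->.
  by rewrite expr0.
Qed.

Lemma gaussian_span_schwartz f : gaussian_span f -> schwartz f.
Proof.
move=> sf; split; first exact: gaussian_span_smooth.
by move=> al be; exact/gaussian_span_decay/gaussian_span_partials.
Qed.

End gaussian_span.

(** * Lacunary superposition of slabs and its L^p norm *)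

Section test_functions.
Context (R : realType).

(** This is convexity of t^p: the graph lies above its tangent at A + B. It follows from Young's
    inequality for A and (A + B)^(p-1) with exponents p and p / (p-1). *)
Lemma powRD_le (p A B : R) : 1 < p -> 0 <= A -> 0 <= B ->
  (A + B) `^ p <= A `^ p + p * ((A + B) `^ (p - 1) * B).
Proof.
move=> p1 A0 B0.
have p0 : 0 < p by rewrite (lt_trans _ p1).
have p10 : 0 < p - 1 by rewrite subr_gt0.
have pE : (p - 1) * (p / (p - 1)) = p by rewrite mulrCA divff ?mulr1 ?gt_eqF.
have := @conjugate_powR R A ((A + B) `^ (p - 1)) p (p / (p - 1)) A0 (powR_ge0 _ _) p0.
rewrite divr_gt0// => /(_ isT); rewrite -powRrM pE invf_div.
have -> : p^-1 + (p - 1) / p = 1 by field; rewrite gt_eqF.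
move=> /(_ erefl) young.
have SE : (A + B) `^ p = (A + B) `^ (p - 1) * (A + B).
  rewrite -[X in _ * X]powRr1 ?addr_ge0// -powRD ?subrK//.
  by apply/implyP => /eqP; lra.
set S := (A + B) `^ p in SE young *; set T := (A + B) `^ (p - 1) in SE young *.
have : p * (A * T) <= A `^ p + (p - 1) * S.
  rewrite -(ler_pM2l p0) in young; apply: (le_trans young).
  by rewrite le_eqVlt; apply/orP; left; apply/eqP; field; rewrite gt_eqF.
by rewrite SE; nra.
Qed.

(** Peel off the top term with [powRD_le]. As e <= 1, the sum through index N is at most 2^(N+1), so
    the increment is at most p (2^(N+1))^(p-1) 2^N e_N, with no cross terms left. *)
Lemma powR_lacunary_sum_le (p : R) (e : nat -> R) (N : nat) : 1 < p ->
  (forall k, 0 <= e k <= 1) ->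
  (\sum_(k < N) 2 ^+ k * e k) `^ p <=
  \sum_(k < N) p * ((2 ^+ k.+1) `^ p * e k).
Proof.
move=> p1 e01; have p0 : 0 < p by rewrite (lt_trans _ p1).
have e0 k : 0 <= e k by case/andP: (e01 k).
have S0 M : 0 <= \sum_(k < M) 2 ^+ k * e k :> R.
  by apply: sumr_ge0 => k _; rewrite mulr_ge0 ?exprn_ge0.
have S2 M : \sum_(k < M) 2 ^+ k * e k <= 2 ^+ M :> R.
  elim: M => [|M IH]; first by rewrite big_ord0 exprn_ge0.
  rewrite big_ord_recr/= exprSr mulr_natr mulr2n lerD//.
  by rewrite ler_piMr ?exprn_ge0//; case/andP: (e01 M).
elim: N => [|N IH]; first by rewrite !big_ord0 powR0// gt_eqF.
have SN := S2 N.+1.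
rewrite big_ord_recr/= in SN; rewrite big_ord_recr/= [leRHS]big_ord_recr/=.
have B0 : 0 <= 2 ^+ N * e N :> R by rewrite mulr_ge0 ?exprn_ge0.
apply: (le_trans (powRD_le p1 (S0 N) B0)).
apply: lerD => //; rewrite ler_pM2l// mulrA ler_wpM2r//.
have -> : (2 ^+ N.+1) `^ p = (2 ^+ N.+1) `^ (p - 1) * 2 ^+ N.+1 :> R.
  rewrite -[X in _ * X]powRr1 ?exprn_ge0// -powRD ?subrK//.
  by apply/implyP => _; rewrite expf_neq0.
apply: ler_pM; rewrite ?powR_ge0 ?exprn_ge0//.
  rewrite ge0_ler_powR ?subr_ge0 ?(ltW p1)// nnegrE ?exprn_ge0//.
  exact: addr_ge0.
by rewrite ler_weXn2l// ler1n.
Qed.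

Lemma integral_gauss (c l : R) : 0 < l ->
  (\int[lebesgue_measure]_t (expR (- (l * (t - c)) ^+ 2))%:E =
   (Num.sqrt pi / l)%:E)%E.
Proof.
(* The standard deviation with 2 s^2 = l^(-2): the normal density of mean [c] then has exponent -(l
   (t - c))^2, and its total mass 1 gives the integral. *)
move=> l0; pose s : R := (l * Num.sqrt 2)^-1.
have s2 : 0 < Num.sqrt 2 :> R by rewrite sqrtr_gt0.
have s0 : s != 0 by rewrite invr_neq0// mulf_neq0 ?gt_eqF.
have sE : s ^+ 2 *+ 2 = l ^- 2.
  rewrite /s exprVn exprMn sqr_sqrtr// -mulr_natr.
  by field; rewrite gt_eqF.
have peak : normal_peak s = l / Num.sqrt pi.
  rewrite /normal_peak -[_ *+ 2]mulrnAl sE sqrtrM ?invr_ge0 ?sqr_ge0//.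
  by rewrite invfM -exprVn sqrtr_sqr ger0_norm ?invrK// invr_ge0 ltW.
have := integral_normal_pdf c s; rewrite (normal_pdfE _ s0).
under eq_integral => t _.
  rewrite /normal_fun sE peak EFinM.
  rewrite (_ : - _ / _ = - (l * (t - c)) ^+ 2); last first.
    by rewrite invrK exprMn mulNr mulrC.
  over.
have sp : 0 < Num.sqrt pi :> R by rewrite sqrtr_gt0 pi_gt0.
rewrite ge0_integralZl_EFin//; last 2 first.
- apply/measurable_EFinP; apply: measurableT_comp => //.
  apply: measurableT_comp => //; apply: measurable_funX => //.
  by apply: measurable_funM => //; exact: measurable_funB.
- by rewrite divr_ge0// ltW.
move=> /(congr1 (fun x => (Num.sqrt pi / l)%:E * x)%E).
rewrite muleA -EFinM mule1 => <-.
by rewrite (_ : _ * _ = 1) ?mul1e//; field; rewrite !gt_eqF.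
Qed.

Lemma dot_snoc (n : nat) (nu : 'rV[R]_n.+1) (x : 'rV[R]_n) t :
  dot nu (snoc x t) = dot (\row_i nu 0 (lift ord_max i)) x + nu 0 ord_max * t.
Proof.
rewrite /dot big_ord_recr/= snoc_max; congr (_ + _); apply: eq_bigr => i _.
rewrite (_ : widen_ord _ i = lift ord_max i) ?snoc_lift ?mxE//.
by apply: val_inj; exact: (esym (lift_max i)).
Qed.

Lemma measurable_gaussian (n : nat) (nu : 'rV[R]_n) (c : R) :
  measurable_fun setT (EFin \o gaussian nu c).
Proof.
apply/measurable_EFinP; apply: continuous_rV_measurable.
exact: continuous_gaussian.
Qed.

Lemma dot_snoc_diag (n : nat) (x : 'rV[R]_n) t :
  dot (snoc x t) (snoc x t) = dot x x + t ^+ 2.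
Proof.
rewrite dot_snoc snoc_max -expr2; congr (dot _ _ + _).
by apply/rowP => i; rewrite mxE snoc_lift.
Qed.

Lemma integral_gaussian_rV (n : nat) :
  (\int[lebesgue_rV R n]_x (gaussian 0 0 x)%:E = (Num.sqrt pi ^+ n)%:E)%E.
Proof.
elim: n => [|n IH].
  rewrite /= integral_dirac//; last exact: measurable_gaussian.
  rewrite diracE mem_set// mul1e /gaussian /dot !big_ord0 expr0n mulr0 addr0 oppr0.
  by rewrite expR0.
rewrite ge0_integral_lebesgue_rVS; last 2 first.
- exact: measurable_gaussian.
- by move=> x; rewrite lee_fin expR_ge0.
transitivity (\int[lebesgue_rV R n]_x ((Num.sqrt pi)%:E * (gaussian 0 0 x)%:E))%E.
  apply: eq_integral => x _.
  have -> : (Num.sqrt pi)%:E = (Num.sqrt pi / 1)%:E :> \bar R by rewrite divr1.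
  rewrite -(@integral_gauss 0 1)// muleC -ge0_integralZl_EFin ?expR_ge0//.
    apply: eq_integral => t _; rewrite -EFinM -expRD; congr (expR _)%:E.
    by rewrite dot_snoc_diag; ring.
  apply/measurable_EFinP; apply: measurableT_comp => //.
  apply: measurableT_comp => //; apply: measurable_funX => //.
  by apply: measurable_funM => //; exact: measurable_funB.
rewrite ge0_integralZl_EFin//; last 2 first.
- by move=> x _; rewrite lee_fin expR_ge0.
- exact: measurable_gaussian.
by rewrite IH exprS EFinM.
Qed.

(** On a line parallel to the last axis, [dot nu] is t - c because the last coordinate of [nu] is 1.
    Dropping t^2 from the squared length leaves a one-dimensional Gaussian whose integral sqrt pi /
    l does not depend on c. *)
Lemma integral_gaussian_rVS_le (n : nat) (nu : 'rV[R]_n.+1) (l : R) :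
  0 < l -> nu 0 ord_max = 1 ->
  (\int[lebesgue_rV R n.+1]_x (gaussian nu (l ^+ 2) x)%:E <=
   (Num.sqrt pi ^+ n.+1 / l)%:E)%E.
Proof.
move=> l0 nu1; rewrite ge0_integral_lebesgue_rVS; last 2 first.
- exact: measurable_gaussian.
- by move=> x; rewrite lee_fin expR_ge0.
have -> : (Num.sqrt pi ^+ n.+1 / l)%:E =
    (\int[lebesgue_rV R n]_x ((Num.sqrt pi / l)%:E * (gaussian 0 0 x)%:E))%E.
  rewrite ge0_integralZl_EFin//; last 3 first.
  - by move=> x _; rewrite lee_fin expR_ge0.
  - exact: measurable_gaussian.
  - by rewrite divr_ge0// ltW.
  by rewrite integral_gaussian_rV -EFinM; congr (_%:E); rewrite exprS; ring.
apply: ge0_le_integral_nonmeasurable => x _.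
  by apply: integral_ge0 => t _; rewrite lee_fin expR_ge0.
pose c := - dot (\row_i nu 0 (lift ord_max i)) x.
rewrite -(@integral_gauss c l)// muleC -ge0_integralZl_EFin ?expR_ge0//.
  apply: ge0_le_integral_nonmeasurable => t _; first by rewrite lee_fin expR_ge0.
  rewrite -EFinM lee_fin -expRD ler_expR dot_snoc_diag dot_snoc nu1.
  by rewrite /c; have := sqr_ge0 t; nra.
apply/measurable_EFinP; apply: measurableT_comp => //.
apply: measurableT_comp => //; apply: measurable_funX => //.
by apply: measurable_funM => //; exact: measurable_funB.
Qed.

(* The widths [2 ^- (k p)] make [f ^ p] comparable to the sum of the [p]-th
   powers of its [N] summands, each of which has integral [O(1)]. *)
Definition test_fun (n : nat) (nu : 'rV[R]_n) (p : R) (N : nat) (x : 'rV[R]_n) : R :=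
  \sum_(k < N) 2 ^+ k * gaussian nu (((2 ^+ k) `^ p) ^+ 2) x.

Lemma gaussian01 (n : nat) (nu : 'rV[R]_n) (c : R) x : 0 <= c ->
  0 <= gaussian nu c x <= 1.
Proof.
move=> c0; rewrite expR_ge0/= -expR0 ler_expR oppr_le0 addr_ge0//; first exact: dot_ge0.
by rewrite mulr_ge0// sqr_ge0.
Qed.

Lemma test_fun_ge0 (n : nat) (nu : 'rV[R]_n) p N x : 0 <= test_fun nu p N x.
Proof. by apply: sumr_ge0 => k _; rewrite mulr_ge0 ?exprn_ge0 ?expR_ge0. Qed.

Lemma test_fun_span (n : nat) (nu : 'rV[R]_n) p N :
  gaussian_span nu (test_fun nu p N).
Proof.
have sg c : 0 <= c -> gaussian_span nu (gaussian nu c) by exact: gaussian_span_gaussian.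
apply: gaussian_span_sum => [|k]; first exact: (sg 0).
by apply/gaussian_spanZ/sg; exact: sqr_ge0.
Qed.

Lemma Lnorm_test_fun_le (n : nat) (nu : 'rV[R]_n.+1) (p : R) (N : nat) :
  1 < p -> nu 0 ord_max = 1 ->
  ('N[lebesgue_rV R n.+1]_p%:E[EFin \o test_fun nu p N] `^ p <=
   (N%:R * (p * 2 `^ p * Num.sqrt pi ^+ n.+1))%:E)%E.
Proof.
move=> p1 nu1; have p0 : 0 < p by rewrite (lt_trans _ p1).
rewrite poweR_Lnorm ?gt_eqF//.
apply: (@le_trans _ _ (\int[lebesgue_rV R n.+1]_x (\sum_(k < N)
   (p * (2 ^+ k.+1) `^ p)%:E * (gaussian nu (((2 ^+ k) `^ p) ^+ 2) x)%:E))%E).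
  apply: ge0_le_integral_nonmeasurable => x _; first exact: poweR_ge0.
  rewrite /= ger0_norm ?test_fun_ge0//.
  under eq_bigr do rewrite -EFinM.
  rewrite sumEFin lee_fin.
  under eq_bigr do rewrite -mulrA.
  apply: (@powR_lacunary_sum_le p (fun k => gaussian nu (((2 ^+ k) `^ p) ^+ 2) x)) => // k.
  by apply: gaussian01; exact: sqr_ge0.
rewrite ge0_integral_sum//; last 2 first.
- move=> k; apply: measurable_funeM; exact: measurable_gaussian.
- move=> k x _; rewrite -EFinM lee_fin mulr_ge0 ?expR_ge0// mulr_ge0 ?powR_ge0//.
  exact: ltW.
rewrite (_ : N%:R * _ = \sum_(k < N) (p * 2 `^ p * Num.sqrt pi ^+ n.+1)); last first.
  by rewrite big_const_ord iter_addr_0 mulr_natl.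
rewrite -sumEFin; apply: lee_sum => k _.
have lk : 0 < (2 ^+ k) `^ p :> R by rewrite powR_gt0// exprn_gt0.
have pk : 0 <= p * (2 ^+ k.+1) `^ p by rewrite mulr_ge0 ?powR_ge0// ltW.
rewrite ge0_integralZl_EFin//; last 2 first.
- by move=> x _; rewrite lee_fin expR_ge0.
- exact: measurable_gaussian.
apply: (@le_trans _ _ ((p * (2 ^+ k.+1) `^ p)%:E *
    (Num.sqrt pi ^+ n.+1 / (2 ^+ k) `^ p)%:E)%E).
  by apply: lee_wpmul2l; [rewrite lee_fin|exact: integral_gaussian_rVS_le].
(* The width 2^(-k p) cancels 2^(k p); the exponent k+1 of the lacunary bound leaves the factor
   2^p. *)
rewrite -EFinM lee_fin exprS powRM ?exprn_ge0//.
rewrite le_eqVlt; apply/orP; left; apply/eqP; field.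
by rewrite gt_eqF.
Qed.

End test_functions.

(** * Power series *)

Section power_series.
Context (R : realType) (n : nat).
Implicit Types (f : 'rV[R]_n -> R) (a h u v : 'rV[R]_n) (al : multi_index n).

Lemma finite_mi_deg_lt (N : nat) : finite_set [set al : multi_index n | (mi_deg al < N)%N].
Proof.
apply: (@sub_finite_set _ _ ((fun F : {ffun 'I_n -> 'I_N} =>
  [ffun i => nat_of_ord (F i)] : multi_index n) @` setT)).
  move=> al /= alN; have lt i : (al i < N)%N.
    by apply: leq_ltn_trans alN; rewrite /mi_deg (bigD1 i)//= leq_addr.
  exists [ffun i => Ordinal (lt i)] => //.
  by apply/ffunP => i; rewrite !ffunE.
by apply: finite_image; exact: finite_finset.
Qed.

Lemma ball_addP a h (r : R) : 0 < r -> (forall i, `|h 0 i| < r) -> ball a r (a + h).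
Proof.
move=> r0 hr; split => // i j; rewrite ord1 !mxE /ball /=.
by rewrite opprD addrA subrr sub0r normrN.
Qed.

(** Such a monomial is 1 or a coordinate. Subtracting the value at 0 treats both cases alike, so
    that a whole sum over these indices is visibly linear. *)
Lemma monomial_linear_part al : (mi_deg al < 2)%N ->
  (forall u v, monomial al (u + v) - monomial al 0 =
     (monomial al u - monomial al (0 : 'rV[R]_n)) + (monomial al v - monomial al 0)) /\
  (forall (t : R) u, monomial al (t *: u) - monomial al 0 =
     t * (monomial al u - monomial al 0)).
Proof.
move=> al2; have [[i ali]|/forallNP al0] := pselect (exists i, (0 < al i)%N).
  have := al2; rewrite /mi_deg (bigD1 i)//= => dE.
  have aljE j : j != i -> al j = 0%N.
    by move=> ji; move: dE; rewrite (bigD1 j)//=; lia.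
  have aliE : al i = 1%N by move: ali dE; lia.
  have mE u : monomial al u = u 0 i.
    rewrite /monomial (bigD1 i)//= aliE expr1 big1 ?mulr1// => j /aljE ->.
    by rewrite expr0.
  by split => [u v|t u]; rewrite !mE !mxE !subr0.
have mE u : monomial al u = 1.
  rewrite /monomial big1// => i _; have /negP := al0 i.
  by rewrite -eqn0Ngt => /eqP ->; rewrite expr0.
by split => [u v|t u]; rewrite !mE !subrr ?addr0 ?mulr0.
Qed.

(** Of the |al| factors d, two are kept as (d/s)^2 s^2 and the others enlarged to s. Every term of
    degree at least 2 is thus compared with its value at the fixed point (s, ..., s), at a quadratic
    gain in d. *)
Lemma monomial_norm_le al h (d s : R) : 0 <= d <= s -> 0 < s -> (2 <= mi_deg al)%N ->
  (forall i, `|h 0 i| <= d) ->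
  `|monomial al h| <= (d / s) ^+ 2 * `|monomial al (const_mx s : 'rV[R]_n)|.
Proof.
move=> /andP[d0 ds] s0 al2 hd; rewrite /monomial !normr_prod.
apply: (@le_trans _ _ (\prod_i d ^+ al i)).
  apply: ler_prod => i _; rewrite normr_ge0/= normrX.
  by rewrite lerXn2r// nnegrE ?(le_trans (normr_ge0 _) (hd i)).
under [X in _ <= _ * X]eq_bigr do rewrite mxE normrX (gtr0_norm s0).
rewrite !prodrXr -/(mi_deg al) -(subnKC al2) !exprD expr_div_n.
rewrite mulrA divfK ?expf_neq0 ?gt_eqF//.
by rewrite ler_wpM2l ?sqr_ge0// lerXn2r// nnegrE ltW.
Qed.

(** Absolute summability at the single point a + (s, ..., s) bounds the terms of degree at least 2
    by a multiple of d^2, uniformly in the truncation. The linear part [L] is left abstract here,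
    since term-by-term differentiation has not been justified. *)
Lemma analytic_at_taylor1 f a : analytic_at f a ->
  exists (L : 'rV[R]_n -> R) (K s : R), [/\ 0 < s, 0 <= K,
    (forall u v, L (u + v) = L u + L v), (forall t u, L (t *: u) = t * L u) &
    forall h d, 0 <= d <= s -> (forall i, `|h 0 i| <= d) ->
      `|f (a + h) - f a - L h| <= K * d ^+ 2].
Proof.
move=> [c [r [r0 fr]]]; pose s := r / 2.
have s0 : 0 < s by rewrite divr_gt0.
have sr : s < r by rewrite /s; lra.
have finN := finite_mi_deg_lt.
pose T N h := \sum_(al \in [set al | (mi_deg al < N)%N]) c al * monomial al h.
pose L h := T 2%N h - T 2%N 0.
pose w : 'rV[R]_n := const_mx s.
have wE i : `|w 0 i| = s by rewrite mxE gtr0_norm.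
have wr i : `|w 0 i| < r by rewrite wE.
have [+ _] := fr (a + w) (ball_addP a r0 wr).
rewrite addrAC subrr add0r.
rewrite /summable; set E := esum _ _ => Eoo.
have E0 : (0 <= E)%E by apply: esum_ge0 => al _; exact: abse_ge0.
pose K0 := fine E.
have EK : E = K0%:E by rewrite fineK// ge0_fin_numE.
have K00 : 0 <= K0 by exact: fine_ge0.
have key h d N : 0 <= d <= s -> (forall i, `|h 0 i| <= d) -> (2 <= N)%N ->
    `|T N h - T 2%N h| <= K0 / s ^+ 2 * d ^+ 2.
  move=> ds hd N2; rewrite /T (fsbigID [set al | (mi_deg al < 2)%N] [set al | (mi_deg al < N)%N])//=.
  rewrite (_ : _ `&` [set al | (mi_deg al < 2)%N] = [set al | (mi_deg al < 2)%N]); last first.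
    by apply/seteqP; split => al /=; [case|move=> al2; split => //; exact: leq_trans al2 _].
  rewrite addrAC subrr add0r; set A := _ `&` _.
  have finA : finite_set A by exact: finite_setIl.
  rewrite fsbig_finite//=; apply: (le_trans (ler_norm_sum _ _ _)).
  apply: (@le_trans _ _ ((d / s) ^+ 2 * \sum_(al <- fset_set A) `|c al * monomial al w|)).
    rewrite mulr_sumr big_seq [leRHS]big_seq; apply: ler_sum => al.
    rewrite in_fset_set// inE => -[_ /negP]; rewrite -leqNgt => al2.
    by rewrite !normrM mulrCA ler_wpM2l// monomial_norm_le.
  rewrite (_ : K0 / _ * _ = (d / s) ^+ 2 * K0); last by field; rewrite gt_eqF.
  rewrite ler_wpM2l ?sqr_ge0// -lee_fin -EK -fsbig_finite//= -fsumEFin//.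
  by apply: ereal_sup_ubound; exists A.
have fT h d : 0 <= d <= s -> (forall i, `|h 0 i| <= d) ->
    `|f (a + h) - T 2%N h| <= K0 / s ^+ 2 * d ^+ 2.
  (* Passage to the limit: the truncation at [maxn M 2] is within e of [f (a + h)] and is long
     enough for [key]. *)
  move=> ds hd; apply/ler_addgt0Pl => e e0.
  have hr i : `|h 0 i| < r.
    by apply: (le_lt_trans (hd i)); case/andP: ds => _; move/le_lt_trans; apply.
  have [_] := fr (a + h) (ball_addP a r0 hr); rewrite addrAC subrr add0r => /cvgrPdist_le/(_ e e0)[M _ Me].
  have := Me (maxn M 2) (leq_maxl _ _) => /= Me'.
  rewrite -(subrKA (T (maxn M 2) h)); apply: (le_trans (ler_normD _ _)).
  by apply: lerD => //; exact: key (leq_maxr _ _).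
have LE h : L h = \sum_(al <- fset_set [set al | (mi_deg al < 2)%N])
    c al * (monomial al h - monomial al 0).
  rewrite /L /T !fsbig_finite//= -sumrB; apply: eq_bigr => al _.
  by rewrite mulrBr.
exists L, (K0 / s ^+ 2), s; split => //.
- by rewrite divr_ge0// sqr_ge0.
- move=> u v; rewrite !LE -big_split/= big_seq [RHS]big_seq; apply: eq_bigr => al.
  rewrite in_fset_set// inE => /monomial_linear_part[-> _].
  by rewrite mulrDr.
- move=> t u; rewrite !LE mulr_sumr big_seq [RHS]big_seq; apply: eq_bigr => al.
  rewrite in_fset_set// inE => /monomial_linear_part[_ ->].
  by rewrite mulrCA.
- move=> h d ds hd; have -> : f a = T 2%N 0.
    apply/eqP; rewrite -subr_eq0 -normr_le0.
    have := @fT 0 0; rewrite lexx (ltW s0) addr0 expr0n mulr0; apply => // i.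
    by rewrite mxE normr0.
  by rewrite (_ : _ - _ - _ = f (a + h) - T 2%N h) ?fT// /L; ring.
Qed.

Lemma coord_le_sum v i : `|v 0 i| <= \sum_j `|v 0 j|.
Proof. by rewrite (bigD1 i)//= lerDl sumr_ge0. Qed.

Lemma is_derive_of_taylor1 f a (L : 'rV[R]_n -> R) (K s : R) v : 0 < s -> 0 <= K ->
  (forall t u, L (t *: u) = t * L u) ->
  (forall h d, 0 <= d <= s -> (forall i, `|h 0 i| <= d) ->
    `|f (a + h) - f a - L h| <= K * d ^+ 2) ->
  is_derive a v f (L v).
Proof.
move=> s0 K0 LZ tay; pose D := 1 + \sum_i `|v 0 i|.
have D0 : 0 < D by rewrite ltr_pwDl// sumr_ge0.
have cv : h^-1 *: ((f \o shift a) (h *: v) - f a) @[h --> (0 : R)^'] --> (L v : R).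
  apply/cvgrPdist_le => e e0; near=> h.
  have h0 : h != 0 by near: h; exact: nbhs_dnbhs_neq.
  have hs : `|h| <= s / D.
    by apply: ltW; near: h; apply: dnbhs0_lt; rewrite divr_gt0.
  have he : `|h| <= e / (K * D ^+ 2 + 1).
    apply: ltW; near: h; apply: dnbhs0_lt; rewrite divr_gt0//.
    by rewrite ltr_wpDl// mulr_ge0// sqr_ge0.
  have := tay (h *: v) (`|h| * D); rewrite mulr_ge0 ?(ltW D0)//= -ler_pdivlMr// hs.
  move=> /(_ isT) tayh.
  have {tayh} : `|f (a + h *: v) - f a - L (h *: v)| <= K * (`|h| * D) ^+ 2.
    apply: tayh => i; rewrite mxE normrM ler_wpM2l//.
    by rewrite (le_trans (coord_le_sum _ _))// lerDr.
  rewrite LZ /GRing.scale/= (addrC a) distrC => tayh.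
  rewrite (_ : L v - _ = h^-1 * (h * L v - (f (h *: v + a) - f a))); last first.
    by rewrite [RHS]mulrBr mulKf.
  rewrite normrM normfV ler_pdivrMl ?normr_gt0//; apply: (le_trans tayh).
  rewrite (_ : K * _ = `|h| * (`|h| * (K * D ^+ 2))); last by ring.
  rewrite ler_wpM2l//.
  have KD : 0 <= K * D ^+ 2 by rewrite mulr_ge0// sqr_ge0.
  rewrite ler_pdivlMr ?ltr_wpDl// in he; apply: le_trans he.
  by rewrite ler_wpM2l// lerDl.
by apply: DeriveDef; [apply/cvg_ex; exists (L v)|exact: cvg_lim cv].
Unshelve. all: by end_near. Qed.

(** The remainder bound makes [L] the derivative in every direction, in particular along the basis
    vectors; linearity then identifies it with the gradient. *)
Lemma analytic_at_taylor f a : analytic_at f a ->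
  (forall v, is_derive a v f (dot (gradient f a) v)) /\
  exists K s : R, [/\ 0 < s, 0 <= K &
    forall h d, 0 <= d <= s -> (forall i, `|h 0 i| <= d) ->
      `|f (a + h) - f a - dot (gradient f a) h| <= K * d ^+ 2].
Proof.
move=> /analytic_at_taylor1[L [K [s [s0 K0 LD LZ tay]]]].
have dL v := is_derive_of_taylor1 v s0 K0 LZ tay.
have LE v : L v = dot (gradient f a) v.
  have L0 : L 0 = 0 by rewrite -(scale0r 0) LZ mul0r.
  have Lsum (I : Type) (r : seq I) (F : I -> 'rV[R]_n) :
      L (\sum_(i <- r) F i) = \sum_(i <- r) L (F i).
    by elim: r => [|i r IH]; rewrite ?big_nil// !big_cons LD IH.
  rewrite [in LHS](row_sum_delta v) Lsum; apply: eq_bigr => i _.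
  rewrite LZ mulrC mxE; congr (_ * _).
  by rewrite /partial; have := dL (delta_mx 0 i) => ?; rewrite derive_val.
split; first by move=> v; rewrite -LE; exact: dL.
by exists K, s; split => // h d ds hd; rewrite -LE; exact: tay.
Qed.

Lemma analytic_at_locally_close f a : analytic_at f a -> forall e : R, 0 < e ->
  exists2 r, 0 < r & forall x, ball a r x -> `|f x - f a| < e.
Proof.
move=> /analytic_at_taylor[_ [K [s [s0 K0 tay]]]] e e0.
pose G := \sum_i `|gradient f a 0 i|; have G0 : 0 <= G by rewrite sumr_ge0.
pose C := K * s + G + 1; have C0 : 0 < C by rewrite ltr_wpDl// addr_ge0// mulr_ge0// ltW.
pose r := Num.min s (e / C); have r0 : 0 < r by rewrite lt_min s0 divr_gt0.
exists r => // x [_ xr].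
have hr i : `|(x - a) 0 i| <= r.
  by have := xr 0 i; rewrite /ball/= !mxE distrC => /ltW.
have rs : r <= s by rewrite ge_min lexx.
have := tay (x - a) r; rewrite (ltW r0) rs (addrC a) subrK => /(_ isT hr) xt.
have dG : `|dot (gradient f a) (x - a)| <= G * r.
  rewrite mulr_suml (le_trans (ler_norm_sum _ _ _))// ler_sum// => i _.
  by rewrite normrM ler_wpM2l.
rewrite -[X in `|X|](subrK (dot (gradient f a) (x - a))).
apply: (le_lt_trans (ler_normD _ _)).
apply: (@le_lt_trans _ _ ((K * s + G) * r)).
  rewrite mulrDl lerD// (le_trans xt)// expr2 -mulrA ler_wpM2l// ler_wpM2r//.
  exact: ltW.
have re : r <= e / C by rewrite ge_min lexx orbT.
rewrite ler_pdivlMr// in re; apply: lt_le_trans re.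
by rewrite mulrC ltr_pM2l// /C ltrDl.
Qed.

End power_series.

(** * Sublevel sets *)

Section sublevel.
Context (R : realType) (n : nat).

Lemma open_sublevel (H : 'rV[R]_n -> R) (B : set 'rV[R]_n) (c : R) : open B ->
  (forall x, B x -> {for x, continuous H}) -> open (B `&` [set x | `|H x| < c]).
Proof.
move=> oB cH; rewrite openE => x [Bx /= Hxc].
apply: filterI; first exact: open_nbhs_nbhs.
have e0 : 0 < c - `|H x| by rewrite subr_gt0.
have /cvgrPdist_lt/(_ _ e0) := cH x Bx; apply: filterS => t /= Ht.
have := ler_normD (H t - H x) (H x); rewrite subrK distrC => /le_lt_trans; apply.
by rewrite -ltrBrDr.
Qed.

(* The translates of the sublevel set by multiples of its width in the i-th
   direction cover a fixed ball, which bounds its measure from below. *)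
Lemma sublevel_measure_ge (H xi : 'rV[R]_n -> R) (b : 'rV[R]_n.-1 -> R)
    (i : 'I_n) (m : nat) (a : 'rV[R]_n) (W : set 'rV[R]_n) :
  open W -> W a -> (forall x, W x -> {for x, continuous H}) ->
  (forall e : R, 0 < e -> exists2 r, 0 < r & forall x, ball a r x -> `|xi x - xi a| < e) ->
  (forall e : R, 0 < e -> exists2 r, 0 < r &
    forall x, ball (col' i a) r x -> `|b x - b (col' i a)| < e) ->
  b (col' i a) = a 0 i ->
  (forall x, W x -> H x = xi x * (x 0 i - b (col' i x)) ^+ m) ->
  exists (r c C : R), [/\ 0 < r, 0 < c, 0 < C, ball a r `<=` W &
    forall j : nat, ((c * 2 ^- j)%:E <=
      lebesgue_rV R n (ball a r `&` [set x | (`|H x| < C * (2 ^- j) ^+ m)%R]))%E].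
Proof.
move=> oW Wa cH cxi cb bE HE.
have [r1 r10 xi1] := cxi 1 ltr01.
have /nbhs_ballP[r2 /= r20 r2W] := open_nbhs_nbhs (conj oW Wa).
pose r := Num.min r1 r2; have r0 : 0 < r by rewrite lt_min r10.
have rW : ball a r `<=` W.
  by apply: subset_trans r2W; apply: le_ball; rewrite ge_min lexx orbT.
have r40 : 0 < r / 4 by rewrite divr_gt0.
have [eta eta0 bclose] := cb _ r40.
pose rho := Num.min eta (r / 4); have rho0 : 0 < rho by rewrite lt_min eta0.
pose X := `|xi a| + 1; have X0 : 0 < X by rewrite ltr_wpDl.
have xiX x : ball a r x -> `|xi x| < X.
  move=> ax; have xix : `|xi x - xi a| < 1.
    by apply: xi1; apply: le_ball ax; rewrite ge_min lexx.
  have := ler_normD (xi x - xi a) (xi a); rewrite subrK => /le_lt_trans; apply.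
  by rewrite addrC ltrD2l.
(* The ball of radius [rho] will be covered by 4 * 2^j translates of the sublevel set, whence the 4
   in [c]. Within distance d = (r/4) 2^(-j) of the graph of [b], |H| < X d^m = C 2^(-j m). *)
pose c := (rho *+ 2) ^+ n / 4; pose C := X * (r / 4) ^+ m.
have c0 : 0 < c by rewrite divr_gt0// exprn_gt0// mulrn_wgt0.
have C0 : 0 < C by rewrite mulr_gt0// exprn_gt0.
exists r, c, C; split => //; move=> j.
pose d := r / 4 * 2 ^- j; have d0 : 0 < d by rewrite mulr_gt0// invr_gt0 exprn_gt0.
set E := _ `&` _.
have mE : measurable E.
  apply: open_rV_measurable; apply: open_sublevel; first exact: ball_open.
  by move=> x /rW; exact: cH.
(* Since 4 * 2^j * d = r, these shifts run through [-r/2, r/2) in steps of d. *)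
pose s (k : nat) : 'rV[R]_n := (k%:R * d - r / 2) *: delta_mx 0 i.
pose F k := (fun x => x + s k) @^-1` E.
have mF k : measurable (F k).
  by rewrite /F -[X in measurable X]setTI; exact: measurable_fun_rV_shift.
have cover : ball a rho `<=` \big[setU/set0]_(k < 4 * 2 ^ j) F k.
  move=> x [_ ax]; rewrite -bigcup_mkord.
  have ax4 l : `|x 0 l - a 0 l| < r / 4.
    by have := ax 0 l; rewrite /ball/= distrC => /lt_le_trans; apply; rewrite ge_min lexx orbT.
  have : `|b (col' i x) - b (col' i a)| < r / 4.
    apply: bclose; split => // ? l; rewrite ord1 !mxE.
    by apply: le_ball (ax 0 _); rewrite ge_min lexx.
  rewrite bE ltr_distl => /andP[b1 b2].
  have := ax4 i; rewrite ltr_distl => /andP[x1 x2].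
  pose u := b (col' i x) - x 0 i.
  (* Both [x 0 i] and [b (col' i x)] are within r/4 of [a 0 i], so |u| < r/2. Rounding down picks
     the shift that brings x onto the graph of [b] or less than d below it. *)
  have u1 : 0 <= (u + r / 2) / d by rewrite divr_ge0 ?(ltW d0)// /u; lra.
  have := Num.Theory.truncn_itv u1; set k := Num.trunc _ => /andP[k1 k2].
  rewrite ler_pdivlMr// in k1; rewrite ltr_pdivrMr// in k2.
  have kr : k%:R * d < r by apply: (le_lt_trans k1); rewrite /u; lra.
  have k4 : (k < 4 * 2 ^ j)%N.
    rewrite -(ltr_nat R) natrM natrX -(ltr_pM2r d0); apply: (lt_le_trans kr).
    rewrite /d le_eqVlt; apply/orP; left; apply/eqP; field.
    by rewrite expf_neq0.
  exists k => //; rewrite /F /= /E.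
  have kd0 : 0 <= k%:R * d by rewrite mulr_ge0 ?(ltW d0).
  have Br : ball a r (x + s k).
    split => // ? l; rewrite ord1 !mxE /ball/= distrC.
    rewrite addrAC; apply: (le_lt_trans (ler_normD _ _)); rewrite normrM.
    have sr : `|k%:R * d - r / 2| <= r / 2 by rewrite ler_norml; lra.
    have dl : `|((0 == 0 :> 'I_1) && (l == i))%:R| <= 1 :> R.
      by case: (_ && _); rewrite ?normr1 ?normr0.
    have := ax4 l; have := normr_ge0 (k%:R * d - r / 2).
    have := normr_ge0 (((0 == 0 :> 'I_1) && (l == i))%:R : R); nra.
  split => //=; rewrite HE; last exact: rW.
  have -> : col' i (x + s k) = col' i x.
    apply/rowP => l; rewrite !mxE eq_sym (negbTE (neq_lift _ _)) andbF mulr0 addr0.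
    by [].
  have -> : (x + s k) 0 i = x 0 i + (k%:R * d - r / 2).
    by rewrite !mxE !eqxx mulr1.
  have ud : `|x 0 i + (k%:R * d - r / 2) - b (col' i x)| <= d.
    by rewrite ler_norml; move: k1 k2; rewrite /u -[k.+1%:R]natr1 mulrDl mul1r; lra.
  rewrite normrM normrX -mulrA -exprMn -/d.
  apply: (@le_lt_trans _ _ (`|xi (x + s k)| * d ^+ m)).
    by rewrite ler_wpM2l// lerXn2r// nnegrE ltW.
  by rewrite ltr_pM2r ?exprn_gt0// xiX.
have mB : measurable (ball a rho) by apply: open_rV_measurable; exact: ball_open.
have le1 : (((rho *+ 2) ^+ n)%:E <= (4 * 2 ^ j)%:R%:E * lebesgue_rV R n E)%E.
  rewrite -(lebesgue_rV_ball a rho0).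
  apply: le_trans (content_subadditive (lebesgue_rV R n) (fun k _ => mF k) mB cover) _.
  rewrite (eq_bigr (fun=> lebesgue_rV R n E)); last by move=> k _; exact: lebesgue_rV_shift.
  by rewrite big_const_ord iter_addr_0 mule_natl.
have k0 : 0 < (4 * 2 ^ j)%:R :> R by rewrite ltr0n muln_gt0 expn_gt0.
rewrite -(@lee_pmul2l _ (4 * 2 ^ j)%:R%:E)//; apply: le_trans le1.
rewrite -EFinM lee_fin natrM natrX /c le_eqVlt; apply/orP; left; apply/eqP; field.
by rewrite expf_neq0.
Qed.

End sublevel.

(** * Graphs *)

(* Two block factorisations of [block_mx 1 (- v) v^T 1]. *)
Lemma det_1D_trmx_mul (F : comNzRingType) (n : nat) (v : 'rV[F]_n) :
  \det (1%:M + v^T *m v) = 1 + (v *m v^T) 0 0.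
Proof.
pose A := (block_mx 1%:M 0 v^T 1%:M : 'M[F]_(1 + n)).
have E : A *m block_mx 1%:M (- v) 0 (1%:M + v^T *m v) =
         block_mx (1%:M + v *m v^T) (- v) 0 1%:M *m A.
  rewrite !mulmx_block !mulmx1 !mul1mx !mul0mx !mulmx0 !addr0 ?add0r.
  by rewrite mulmxN mulNmx addrCA addNr addr0 addrK.
have := congr1 determinant E; rewrite !det_mulmx !det_lblock !det_ublock.
rewrite !det1 !mul1r !mulr1 => ->.
by rewrite [\det _]det_mx11 !mxE eqxx.
Qed.

Section graph.
Context (R : realType) (n : nat).
Implicit Types (g : 'rV[R]_n -> R) (V : set 'rV[R]_n) (u z : 'rV[R]_n).

Lemma dot_snoc2 (w x : 'rV[R]_n) (s t : R) :
  dot (snoc w s) (snoc x t) = dot w x + s * t.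
Proof.
rewrite dot_snoc snoc_max; congr (dot _ _ + _).
by apply/rowP => i; rewrite mxE snoc_lift.
Qed.

(** Iterated partial derivatives stay in the class [P] made of this coordinate and the constants. *)
Lemma smooth_on_coord V (i : 'I_n) : smooth_on V (fun x : 'rV[R]_n => x 0 i).
Proof.
pose P f := f = (fun x : 'rV[R]_n => x 0 i) \/ exists c : R, f = cst c.
have Pd f : P f -> continuous f /\
    forall k, exists2 d : R, P (cst d) & forall x, is_derive x (delta_mx 0 k) f d.
  case => [->|[c ->]]; split.
  - by move=> x; exact: coord_continuous.
  - move=> k; exists ((delta_mx 0 k : 'rV[R]_n) 0 i).
      by right; exists ((delta_mx 0 k : 'rV[R]_n) 0 i).
    by move=> x; exact: is_derive_coord.
  - by move=> x; exact: cst_continuous.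
  - by move=> k; exists 0; [right; exists 0|move=> x; exact: is_derive_cst].
have Ps s : P (partials s (fun x : 'rV[R]_n => x 0 i)).
  elim: s => [|k s IH]/=; first by left.
  have [_ /(_ k)[d Pcd dd]] := Pd _ IH.
  rewrite (_ : partial k _ = cst d)//; apply/funext => x.
  by rewrite /partial derive_val.
move=> s x _; have [cs ds] := Pd _ (Ps s); split; first exact: cs.
by move=> k; have [d _ dd] := ds k; exact: ex_derive.
Qed.

Lemma graph_pt_coord g j : (fun u => graph_pt g u 0 j) =
  if unlift ord_max j is Some i then (fun u => u 0 i) else g.
Proof. by apply/funext => u; rewrite mxE; case: unlift. Qed.

Lemma smooth_on_graph_pt g V j : smooth_on V g ->
  smooth_on V (fun u => graph_pt g u 0 j).
Proof.
by move=> sg; rewrite graph_pt_coord; case: unlift => [i|//]; exact: smooth_on_coord.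
Qed.

Lemma jacobian_rows_graph_pt g u : jacobian_rows (graph_pt g) u =
  \matrix_(i, j) if unlift ord_max j is Some k then (i == k)%:R else gradient g u 0 i.
Proof.
apply/matrixP => i j; rewrite !mxE graph_pt_coord; case: unlift => [k|//].
rewrite /partial; have dk := is_derive_coord k u (delta_mx 0 i).
by rewrite derive_val mxE eqxx /= eq_sym.
Qed.

Lemma jacobian_rows_graph_pt_gram g u :
  jacobian_rows (graph_pt g) u *m (jacobian_rows (graph_pt g) u)^T =
  1%:M + (gradient g u)^T *m gradient g u.
Proof.
apply/matrixP => i j; rewrite jacobian_rows_graph_pt !mxE big_ord_recr/= !mxE.
rewrite unlift_none big_ord1 !mxE; congr (_ + _).
rewrite (bigD1 i)//= big1 ?addr0.
  rewrite !mxE (_ : widen_ord _ i = lift ord_max i) ?liftK ?eqxx ?mul1r 1?eq_sym//.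
  by apply: val_inj; exact: (esym (lift_max i)).
move=> k ki; rewrite !mxE (_ : widen_ord _ k = lift ord_max k) ?liftK.
  by rewrite eq_sym (negbTE ki) mul0r.
by apply: val_inj; exact: (esym (lift_max k)).
Qed.

(** The Gram determinant is 1 + |grad g|^2. The bound lets the area element be discarded from lower
    estimates. *)
Lemma area_element_graph_pt_ge1 g u : 1 <= area_element (graph_pt g) u.
Proof.
rewrite /area_element jacobian_rows_graph_pt_gram det_1D_trmx_mul.
rewrite -[leLHS]sqrtr1 ler_sqrt; last first.
  by rewrite addr_ge0// mxE sumr_ge0// => i _; rewrite !mxE -expr2 sqr_ge0.
by rewrite lerDl mxE sumr_ge0// => i _; rewrite !mxE -expr2 sqr_ge0.
Qed.

Lemma local_parametrization_graph_pt (S U : set 'rV[R]_n.+1) V g :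
  open U -> open V -> S `&` U = graph_pt g @` V -> smooth_on V g ->
  local_parametrization S V U (graph_pt g).
Proof.
move=> oU oV SU sg; split => //.
- by move=> j; exact: smooth_on_graph_pt.
- move=> u _; apply/row_freeP.
  (* The Jacobian is the identity with one extra column; forgetting the last coordinate is a right
     inverse. *)
  exists (\matrix_(j, k) if unlift ord_max j is Some l then (l == k)%:R else 0).
  rewrite jacobian_rows_graph_pt; apply/matrixP => i k; rewrite !mxE big_ord_recr/=.
  rewrite !mxE unlift_none mulr0 addr0 (bigD1 i)//= big1 ?addr0.
    rewrite !mxE (_ : widen_ord _ i = lift ord_max i) ?liftK ?eqxx ?mul1r//.
    by apply: val_inj; exact: (esym (lift_max i)).
  move=> l li; rewrite !mxE (_ : widen_ord _ l = lift ord_max l) ?liftK.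
    by rewrite eq_sym (negbTE li) mul0r.
  by apply: val_inj; exact: (esym (lift_max l)).
- rewrite SU; split.
  + by move=> u Vu; exists u.
  + move=> u v _ _ /rowP uv; apply/rowP => i.
    by have := uv (lift ord_max i); rewrite !snoc_lift.
  + by move=> _ [u Vu <-]; exists u.
Qed.

Lemma tangent_space_graph_pt (S U : set 'rV[R]_n.+1) V g z v :
  open V -> V z -> S `&` U = graph_pt g @` V ->
  is_derive z v g (dot (gradient g z) v) ->
  tangent_space S (graph_pt g z) (snoc v (dot (gradient g z) v)).
Proof.
move=> oV Vz SU dg.
exists (fun h : R => graph_pt g (h *: v + z)); split.
- by rewrite scale0r add0r.
- have : \forall h \near (0 : R), V (h *: v + z).
    have : (fun h : R => h *: v + z) @ (0 : R) --> z.
      rewrite -[X in _ --> X]add0r -(scale0r v).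
      apply: cvgD; last exact: cvg_cst.
      by apply: cvgZr_tmp; exact: cvg_id.
    by apply; exact: open_nbhs_nbhs.
  apply: filterS => h Vh.
  have : (graph_pt g @` V) (graph_pt g (h *: v + z)) by exists (h *: v + z).
  by rewrite -SU => -[].
- have dj i j : is_derive (0 : R) (1 : R)
      (fun h : R => graph_pt g (h *: v + z) i j) (snoc v (dot (gradient g z) v) i j).
    rewrite ord1; have [k ->|->] := unliftP ord_max j.
      rewrite snoc_lift (_ : (fun _ => _) = (fun h : R => h * v 0 k + z 0 k)).
        by apply: is_derive_eq; rewrite /GRing.scale/=; ring.
      by apply/funext => h; rewrite snoc_lift !mxE.
    rewrite snoc_max (_ : (fun _ => _) = (fun h : R => g (h *: v + z))); last first.
      by apply/funext => h; rewrite snoc_max.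
    case: dg => dg1 dg2; apply: DeriveDef; first exact: (derivable1P g z v).1.
    rewrite -dg2 /derive; set g1 := fun h => h^-1 *: _; set g2 := fun h => h^-1 *: _.
    suff -> : g1 = g2 by [].
    by apply/funext => h; rewrite /g1 /g2 /= addr0 scale0r add0r [_%:A]mulr1.
  have dm : derivable (fun h : R => graph_pt g (h *: v + z)) (0 : R) 1.
    by apply/derivable_mxP => i j; exact: ex_derive.
  apply: DeriveDef => //; rewrite derive_mx//; apply/matrixP => i j.
  by rewrite mxE; have dij := dj i j; rewrite derive_val.
Qed.

End graph.

(** * Lower and upper bounds for the maximal operator *)

Section lower_bound.
Context (R : realType).

Lemma gaussian_ge (n : nat) (nu w : 'rV[R]_n) (l Q D : R) :
  dot w w <= Q -> `|l * dot nu w| <= D -> expR (- (Q + D ^+ 2)) <= gaussian nu (l ^+ 2) w.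
Proof.
move=> wQ lD; rewrite ler_expR lerN2 lerD// -exprMn -(real_normK (num_real (l * _))).
by rewrite lerXn2r// nnegrE (le_trans _ lD).
Qed.

(** A single dilation t already bounds the supremum from below, and its average can be computed in
    the chart because [phi] vanishes outside [U]. *)
Lemma integral_local_parametrization_le_maximal (n : nat) (S U : set 'rV[R]_n.+1)
    (sigma : {measure set 'rV[R]_n.+1 -> \bar R}) (V : set 'rV[R]_n) psi
    (phi f : 'rV[R]_n.+1 -> R) (x : 'rV[R]_n.+1) (t : R) :
  surface_measure S sigma -> local_parametrization S V U psi ->
  continuous phi -> (forall s, 0 <= phi s) -> [set s | phi s != 0] `<=` U ->
  continuous f -> (forall s, 0 <= f s) -> 0 < t ->
  (\int[lebesgue_rV R n]_(u in V)
     (f (x - t *: psi u) * phi (psi u) * area_element psi u)%:E <=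
   maximal_operator S sigma phi f x)%E.
Proof.
move=> [_ hs] lp cphi phi0 phiU cf f0 t0.
pose F s := (f (x - t *: s) * phi s)%:E.
have F0 s : (0 <= F s)%E by rewrite lee_fin mulr_ge0.
have mF : measurable_fun setT F.
  apply/measurable_EFinP; apply: continuous_rV_measurable => s.
  apply: continuousM; last exact: cphi.
  have cg : {for s, continuous (fun s : 'rV[R]_n.+1 => x - t *: s)}.
    by apply: continuousB; [exact: cst_continuous|exact: scaler_continuous].
  exact: (@continuous_comp 'rV[R]_n.+1 'rV[R]_n.+1 R (fun s => x - t *: s) f s cg (cf _)).
have -> : (\int[lebesgue_rV R n]_(u in V)
     (f (x - t *: psi u) * phi (psi u) * area_element psi u)%:E =
     \int[sigma]_(s in S) F s)%E.
  rewrite (_ : \int[sigma]_(s in S) F s = \int[sigma]_(s in S `&` U) F s)%E.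
    rewrite (hs _ _ _ lp F mF F0); apply: eq_integral => u _.
    by rewrite -EFinM.
  rewrite integral_mkcond [RHS]integral_mkcond; congr integral; apply/funext => s.
  rewrite !patchE in_setI; case: ifP => //= _; case: ifPn => // /negP sU.
  have [phis0|phis0] := eqVneq (phi s) 0; first by rewrite /F phis0 mulr0.
  by exfalso; apply: sU; rewrite inE; exact: phiU.
apply: (@le_trans _ _ `|\int[sigma]_(s in S) F s|%E); first exact: lee_abs.
by apply: ereal_sup_ubound; exists t.
Qed.

(** Additivity is applied to the measurable step function; [F], which will contain the area element,
    enters through monotonicity alone. *)
Lemma sum_measure_le_integral (n N : nat) (V : set 'rV[R]_n) (E : nat -> set 'rV[R]_n)
    (w : nat -> R) (F : 'rV[R]_n -> R) :
  measurable V -> (forall j, measurable (E j)) -> (forall j, E j `<=` V) ->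
  (forall j, 0 <= w j) ->
  (forall u, V u -> \sum_(j < N) w j * \1_(E j) u <= F u) ->
  (\sum_(j < N) (w j)%:E * lebesgue_rV R n (E j) <=
   \int[lebesgue_rV R n]_(u in V) (F u)%:E)%E.
Proof.
move=> mV mE EV w0 wF.
apply: (@le_trans _ _ (\int[lebesgue_rV R n]_(u in V)
    \sum_(j < N) ((w j)%:E * (\1_(E j) u)%:E))%E).
  rewrite ge0_integral_sum//; last 2 first.
  - move=> j; apply: measurable_funeM; apply/measurable_EFinP.
    exact: measurable_indic.
  - by move=> j u _; rewrite -EFinM lee_fin mulr_ge0// indicE.
  apply: lee_sum => j _; rewrite ge0_integralZl_EFin//; last first.
    by apply/measurable_EFinP; exact: measurable_indic.
  by rewrite integral_indic// setIidl//; exact: EV.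
apply: ge0_le_integral_nonmeasurable => u Vu.
  by apply: sume_ge0 => j _; rewrite -EFinM lee_fin mulr_ge0// indicE.
under eq_bigr do rewrite -EFinM.
by rewrite sumEFin lee_fin wF.
Qed.

End lower_bound.

(** On the sublevel set of scale j the j-th Gaussian is at least [gam]. With height 2^j and a set of
    measure at least c 2^(-j), each scale contributes at least [kappa], whatever j is. *)
Lemma maximal_operator_test_fun_ge (R : realType) (n : nat)
    (S : set 'rV[R]_n.+1) (y : 'rV[R]_n.+1)
    (sigma : {measure set 'rV[R]_n.+1 -> \bar R})
    (hsigma : surface_measure S sigma)
    (g : 'rV[R]_n -> R) (z : 'rV[R]_n)
    (U : set 'rV[R]_n.+1) (V : set 'rV[R]_n)
    (hU : open U) (hV : open V) (hVz : V z)
    (hgraph : S `&` U = graph_pt g @` V) (hz : graph_pt g z = y)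
    (hg_smooth : smooth_on V g) (hg : analytic_on V g)
    (H : 'rV[R]_n -> R)
    (hH : forall x, H x = g (x + z) - g z - dot (gradient g z) x)
    (hyT : ~ tangent_space S y y)
    (phi : 'rV[R]_n.+1 -> R) (hphi : smooth_on setT phi)
    (hphi_U : closure [set x | phi x != 0] `<=` U)
    (hphi_ge0 : forall x, 0 <= phi x) (hphi_y : phi y != 0)
    (m : nat) (a : nat -> 'rV[R]_n)
    (ha : a k @[k --> \oo] --> (0 : 'rV[R]_n))
    (hform : forall k, exists (i : 'I_n) (W : set 'rV[R]_n)
       (xi : 'rV[R]_n -> R) (b : 'rV[R]_n.-1 -> R),
       [/\ open W /\ W (a k), W `<=` [set x | V (x + z)],
           analytic_on W xi /\ analytic_on (col' i @` W) b,
           xi (a k) != 0 /\ b (col' i (a k)) = a k 0 i &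
           forall x, W x -> H x = xi x * (x 0 i - b (col' i x)) ^+ m])
    (p : R) (hpm : p <= m%:R) :
  exists (rho kappa : R), [/\ 0 < rho, 0 < kappa &
    forall (N : nat) x, ball y rho x ->
      ((N%:R * kappa)%:E <=
       maximal_operator S sigma phi
         (test_fun (snoc (- gradient g z) 1) p N) x)%E].
Proof.
set nu := snoc _ 1.
have cphi : continuous phi by move=> x; have [] := hphi [::] x I.
have [dg _] := analytic_at_taylor (hg z hVz).
have nuE (x : 'rV[R]_n) t : dot nu (snoc x t) = t - dot (gradient g z) x.
  by rewrite dot_snoc2 mul1r dotC dotNr dotC addrC.
pose c0 := dot nu y.
have c0E : c0 = g z - dot (gradient g z) z by rewrite /c0 -hz nuE.
(* If [c0] vanished, then g(z) = <grad g(z), z>, and the tangent vector lifting the direction [z]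
   would be (z, g(z)) = y. *)
have c0_neq0 : c0 != 0.
  apply/eqP => c00; apply: hyT.
  have := tangent_space_graph_pt hV hVz hgraph (dg z).
  rewrite hz (_ : dot (gradient g z) z = g z) -?hz//.
  by apply/eqP; rewrite eq_sym -subr_eq0 -c0E c00.
have c0n : 0 < `|c0| by rewrite normr_gt0.
have phiy : 0 < phi y by rewrite lt_neqAle eq_sym hphi_y hphi_ge0.
have [e1 e10 phie1] : exists2 e1 : R, 0 < e1 &
    forall s, ball y e1 s -> phi y / 2 < phi s.
  have h : 0 < phi y / 2 by rewrite divr_gt0.
  have /cvgrPdist_lt/(_ _ h)/nbhs_ballP[e1 /= e10 he1] := cphi y.
  by exists e1 => // s /he1 /=; rewrite ltr_distl => /andP[_ +]; lra.
pose e := Num.min e1 1; have e0 : 0 < e by rewrite lt_min e10/=.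
have [d d0 dP] : exists2 d : R, 0 < d &
    forall u, ball z d u -> V u /\ ball y e (graph_pt g u).
  have [cg _] := hg_smooth [::] z hVz.
  have /cvgrPdist_lt/(_ _ e0)/nbhs_ballP[d1 /= d10 hd1] := cg.
  have /nbhs_ballP[d2 /= d20 hd2] := open_nbhs_nbhs (conj hV hVz).
  pose d := Num.min (Num.min d1 d2) e.
  have dd1 : d <= d1 by rewrite /d !ge_min lexx.
  have dd2 : d <= d2 by rewrite /d !ge_min lexx orbT.
  have de : d <= e by rewrite /d ge_min lexx orbT.
  exists d; first by rewrite lt_min e0 andbT lt_min d10.
  move=> u zu; split; first exact/hd2/(le_ball dd2).
  rewrite -hz; split => // i j; rewrite ord1.
  have [k ->|->] := unliftP ord_max j.
    by rewrite /graph_pt !snoc_lift; have [_] := le_ball de zu; apply.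
  by rewrite /graph_pt !snoc_max; apply: hd1; exact: le_ball zu.
(* A single a^k is enough; convergence to 0 places it where the cutoff exceeds phi(y)/2. *)
have [k ak] : exists k, ball (0 : 'rV[R]_n) d (a k).
  have [M _ MP] := ha _ (nbhsx_ballx (0 : 'rV[R]_n) _ d0).
  by exists M; exact: MP (leqnn M).
have [i [W [xi [b [[oW Wa] WV [axi ab] [_ bE] HE]]]]] := hform k.
pose W' := W `&` ball (0 : 'rV[R]_n) d.
have W'z x : W' x -> ball z d (x + z).
  move=> [_ [_ xd]]; rewrite addrC; apply: ball_addP => // j.
  by have := xd 0 j; rewrite mxE /ball/= sub0r normrN.
have cH x : W' x -> {for x, continuous H}.
  move=> /W'z/dP[Vx _]; rewrite (_ : H = fun x => g (x + z) - g z - dot (gradient g z) x).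
    have [cg _] := hg_smooth [::] _ Vx.
    have cs : {for x, continuous (fun x : 'rV[R]_n => x + z)}.
      by apply: continuousD; [exact: (fun A => id)|exact: cst_continuous].
    have cgs := @continuous_comp 'rV[R]_n 'rV[R]_n R (fun x => x + z) g x cs cg.
    apply: continuousB; last exact: continuous_dot.
    by apply: continuousB; [exact: cgs|exact: cst_continuous].
  by apply/funext => ?; exact: hH.
have oW' : open W' by apply: openI => //; exact: ball_open.
have [r [c [C [r0 cgt0 Cgt0 rW' muE]]]] := sublevel_measure_ge oW' (conj Wa ak) cH
  (analytic_at_locally_close (axi _ Wa))
  (analytic_at_locally_close (ab _ (ex_intro2 _ _ _ Wa erefl))) bE
  (fun x W'x => HE x W'x.1).
pose E j := ball (a k) r `&` [set x | `|H x| < C * (2 ^- j) ^+ m].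
pose E' j := (fun u => u + (- z)) @^-1` E j.
have mE j : measurable (E j).
  apply: open_rV_measurable; apply: open_sublevel; first exact: ball_open.
  by move=> x /rW'; exact: cH.
have mE' j : measurable (E' j).
  by rewrite /E' -[X in measurable X]setTI; exact: measurable_fun_rV_shift.
have E'P j u : E' j u -> ball z d u.
  by move=> [/rW'/W'z + _]; rewrite subrK.
have E'V j : E' j `<=` V by move=> u /E'P/dP[].
pose Y := \sum_j `|y 0 j| + 1.
have yY j : `|y 0 j| + 1 <= Y by rewrite lerD2r coord_le_sum.
have ballY s (r' : R) : r' <= 1 -> ball y r' s -> forall j, `|s 0 j| <= Y.
  move=> r'1 [_ ys] j; apply: le_trans (yY j).
  have := ler_normD (y 0 j) (s 0 j - y 0 j); rewrite (addrC (y 0 j)) subrK => /le_trans; apply.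
  by rewrite lerD2l (le_trans _ r'1)// distrC ltW//; exact: ys.
(* [Y] bounds the coordinates of x and of the surface points s, and t < 2, so each of the n+1
   coordinates of x - t s is at most 3 Y. The 2 C in [gam] bounds |<nu, x - t s>| rescaled by the
   slab width. *)
pose Q := n.+1%:R * (3 * Y) ^+ 2.
pose gam := expR (- (Q + (2 * C) ^+ 2)).
have gam0 : 0 < gam by exact: expR_gt0.
have c02 : 0 < `|c0| / 2 by rewrite divr_gt0.
have /cvgrPdist_lt/(_ _ c02)/nbhs_ballP[r2 /= r20 hr2] := @continuous_dot R _ nu y.
pose rho := Num.min r2 1.
pose kappa := gam * (phi y / 2) * c.
exists rho, kappa; split; first by rewrite lt_min r20/=.
  by rewrite !mulr_gt0// ?invr_gt0.
move=> N x yx; have [t tdef] : exists t, t = dot nu x / c0 by eexists.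
have tE : `|t - 1| < 2^-1.
  have -> : t - 1 = (dot nu x - c0) / c0 by rewrite tdef mulrBl divff.
  rewrite normrM normfV ltr_pdivrMr// distrC mulrC.
  by apply: hr2; apply: le_ball yx; rewrite ge_min lexx.
have [t0 t2] : 0 < t /\ t < 2 by move: tE; rewrite ltr_distl; lra.
have rho1 : rho <= 1 by rewrite ge_min lexx orbT.
have xY := ballY _ _ rho1 yx.
have lp := local_parametrization_graph_pt hU hV hgraph hg_smooth.
have tspan := test_fun_span nu p N.
apply: le_trans (integral_local_parametrization_le_maximal x hsigma lp cphi hphi_ge0
  (subset_trans (@subset_closure _ _) hphi_U)
  (gaussian_span_continuous tspan) (@test_fun_ge0 _ _ nu p N) t0).
pose w j := 2 ^+ j * (gam * (phi y / 2)).
have w0 j : 0 <= w j.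
  by rewrite mulr_ge0 ?exprn_ge0 ?mulr_ge0 ?invr_ge0// ltW.
apply: (@le_trans _ _ (\sum_(j < N) (w j)%:E * lebesgue_rV R n (E' j))%E).
  rewrite (_ : N%:R * kappa = \sum_(j < N) kappa); last first.
    by rewrite big_const_ord iter_addr_0 mulr_natl.
  rewrite -sumEFin; apply: lee_sum => j _.
  rewrite /E' lebesgue_rV_shift//.
  apply: (@le_trans _ _ ((w j)%:E * (c * 2 ^- j)%:E)%E).
    rewrite -EFinM lee_fin /w /kappa le_eqVlt; apply/orP; left; apply/eqP.
    by field; rewrite expf_neq0.
  by apply: lee_wpmul2l; [rewrite lee_fin|exact: muE].
apply: sum_measure_le_integral => //.
  exact: open_rV_measurable.
move=> u Vu; rewrite /test_fun !mulr_suml; apply: ler_sum => j _.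
rewrite indicE; case: (boolP (u \in E' j)) => [|_]; last first.
  by rewrite mulr0 !mulr_ge0 ?exprn_ge0 ?expR_ge0// sqrtr_ge0.
rewrite inE mulr1 => uE.
have [_ yu] := dP _ (E'P _ _ uE).
have phiu : phi y / 2 <= phi (graph_pt g u).
  by apply/ltW/phie1; apply: le_ball yu; rewrite ge_min lexx.
have ele1 : e <= 1 by rewrite ge_min lexx orbT.
have uY := ballY _ _ ele1 yu.
set v := x - t *: graph_pt g u.
have vQ : dot v v <= Q.
  rewrite /Q mulr_natl -[X in _ *+ X]card_ord -sumr_const; apply: ler_sum => l _.
  rewrite -expr2 -(real_normK (num_real _)) lerXn2r ?nnegrE//.
    by rewrite mulr_ge0// (le_trans _ (yY ord_max))// addr_ge0.
  rewrite !mxE (le_trans (ler_normB _ _))// normrM (gtr0_norm t0).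
  have := xY l; have := uY l; have := normr_ge0 (graph_pt g u 0 l).
  have := normr_ge0 (x 0 l); rewrite !mxE; nra.
have vH : dot nu v = - (t * H (u - z)).
  rewrite /v dotBr dotZr nuE hH subrK dotBr.
  have -> : dot nu x = t * c0 by rewrite tdef divfK.
  by rewrite c0E; ring.
have lv : `|(2 ^+ j) `^ p * dot nu v| <= 2 * C.
  have [_ /= HC] := uE.
  rewrite vH mulrN normrN !normrM (gtr0_norm t0) (ger0_norm (powR_ge0 _ _)).
  (* Here p <= m enters: a slab of width 2^(-j p) is no thinner than the scale 2^(-j m) of the
     sublevel set. *)
  have lm : (2 ^+ j) `^ p <= (2 ^+ j) ^+ m :> R.
    by rewrite -[leRHS]powR_mulrn ?exprn_ge0// ler_powR// exprn_ege1// ler1n.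
  apply: (@le_trans _ _ ((2 ^+ j) ^+ m * (2 * (C * (2 ^- j) ^+ m)))).
    apply: ler_pM; rewrite ?powR_ge0 ?mulr_ge0 ?(ltW t0)//.
    by apply: ler_pM => //; exact: ltW.
  rewrite exprVn le_eqVlt; apply/orP; left; apply/eqP; field.
  by rewrite !expf_neq0.
have := gaussian_ge vQ lv; rewrite -/gam => gv.
rewrite /w -!mulrA ler_wpM2l ?exprn_ge0//.
apply: (@le_trans _ _ (gam * phi (graph_pt g u))).
  by rewrite ler_wpM2l// ltW.
apply: ler_pM => //; first exact: ltW.
by rewrite ler_peMr// area_element_graph_pt_ge1.
Qed.

(** * From growth in N to unboundedness *)

Section unbounded.
Context (R : realType).

(** Chebyshev's inequality without measurability of [f], as it will be applied to a maximal
    function, a supremum over uncountably many t. *)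
Lemma Lnorm_ge_on (d : measure_display) (T : measurableType d)
    (mu : {measure set T -> \bar R}) (A : set T) (c p : R) (f : T -> \bar R) :
  measurable A -> 0 < p -> 0 <= c -> (forall x, A x -> (c%:E <= f x)%E) ->
  ((c `^ p)%:E * mu A <= 'N[mu]_p%:E[f] `^ p)%E.
Proof.
move=> mA p0 c0 cf; rewrite poweR_Lnorm ?gt_eqF//.
rewrite -integral_cst// integral_mkcond.
apply: ge0_le_integral_nonmeasurable => x _; rewrite patchE.
  by case: ifP => // _; rewrite lee_fin powR_ge0.
case: ifPn => [|_]; last exact: poweR_ge0.
rewrite inE => /cf cfx; rewrite -poweR_EFin.
apply: gt0_ler_poweR; [exact: ltW| | |exact: le_trans cfx (lee_abs _)].
  by rewrite in_itv/= leey andbT lee_fin.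
by rewrite in_itv/= leey andbT abse_ge0.
Qed.

(** Boundedness would force N^p <= b N for all N. Because p > 2, N^p is at least N^2, so any integer
    N > b is a contradiction. The constant [C] carries no sign and is replaced by its absolute
    value. *)
Lemma not_bounded_on_Lp (n : nat) (M : ('rV[R]_n.+1 -> R) -> 'rV[R]_n.+1 -> \bar R)
    (f : nat -> 'rV[R]_n.+1 -> R) (p : R) (D kappa rho : R) (y : 'rV[R]_n.+1) :
  2 < p -> 0 < kappa -> 0 < rho -> 0 <= D -> (forall N, schwartz (f N)) ->
  (forall N, ('N[lebesgue_rV R n.+1]_p%:E[EFin \o f N] `^ p <= (N%:R * D)%:E)%E) ->
  (forall N x, ball y rho x -> ((N%:R * kappa)%:E <= M (f N) x)%E) ->
  ~ bounded_on_Lp p M.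
Proof.
move=> p2 kappa0 rho0 D0 sf fD fM [C bC]; have p0 : 0 < p by rewrite (lt_trans _ p2).
pose alpha := (rho *+ 2) ^+ n.+1.
have alpha0 : 0 < alpha by rewrite exprn_gt0// mulrn_wgt0.
have mB : measurable (ball y rho) by apply: open_rV_measurable; exact: ball_open.
have key N : (N%:R * kappa) `^ p * alpha <= `|C| `^ p * (N%:R * D).
  have low : (((N%:R * kappa) `^ p * alpha)%:E <=
      'N[lebesgue_rV R n.+1]_p%:E[M (f N)] `^ p)%E.
    rewrite EFinM -(lebesgue_rV_ball y rho0).
    apply: (Lnorm_ge_on (lebesgue_rV R n.+1) mB p0) => //; last exact: fM.
    by rewrite mulr_ge0// ltW.
  rewrite -lee_fin; apply: (le_trans low).
  have := bC _ (sf N); have := fD N.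
  have := Lnorm_ge0 (lebesgue_rV R n.+1) p%:E (EFin \o f N).
  (* A norm -oo contradicts nonnegativity, and +oo contradicts the finite bound N D. *)
  case: ('N[_]_ _ [EFin \o f N])%E => [r| |]//; last first.
    by rewrite poweRyr ?gt_eqF// leye_eq.
  rewrite lee_fin => r0; rewrite poweR_EFin lee_fin => rD; rewrite -EFinM => MC.
  apply: (@le_trans _ _ ((`|C| * r)%:E `^ p)%E).
    apply: gt0_ler_poweR; first exact: ltW.
    - by rewrite in_itv/= leey andbT Lnorm_ge0.
    - by rewrite in_itv/= leey andbT lee_fin mulr_ge0.
    - by rewrite (le_trans MC)// lee_fin ler_wpM2r// ler_norm.
  by rewrite poweR_EFin lee_fin powRM// ler_wpM2l// powR_ge0.
pose b := `|C| `^ p * D / (kappa `^ p * alpha).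
have ka0 : 0 < kappa `^ p * alpha by rewrite mulr_gt0// powR_gt0.
have b0 : 0 <= b by rewrite divr_ge0 ?(ltW ka0)// mulr_ge0// powR_ge0.
pose N := (Num.trunc b).+1.
have bN : b < N%:R by exact: truncnS_gt.
have N1 : 1 <= N%:R :> R by rewrite ler1n.
have := key N; rewrite powRM ?(ltW kappa0)// -mulrA => kN.
have : N%:R ^+ 2 * (kappa `^ p * alpha) <= N%:R * (`|C| `^ p * D).
  rewrite [leRHS]mulrCA; apply: le_trans kN; rewrite ler_pM2r//.
  by rewrite -powR_mulrn// ler_powR// ltW.
rewrite expr2 -mulrA ler_pM2l ?(lt_le_trans _ N1)// -ler_pdivlMr// -/b.
by rewrite leNgt bN.
Qed.

End unbounded.

Theorem theorem1p2 (R : realType) (n : nat) (hn : (2 <= n)%N)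
    (S : set 'rV[R]_n.+1) (hS : smooth_hypersurface S)
    (y : 'rV[R]_n.+1) (hy : S y)
    (sigma : {measure set 'rV[R]_n.+1 -> \bar R})
    (hsigma : surface_measure S sigma)
    (* near y, S is the graph of the real-analytic function g *)
    (g : 'rV[R]_n -> R) (z : 'rV[R]_n)
    (U : set 'rV[R]_n.+1) (V : set 'rV[R]_n)
    (hU : open U) (hUy : U y) (hV : open V) (hVz : V z)
    (hgraph : S `&` U = graph_pt g @` V) (hz : graph_pt g z = y)
    (hg_smooth : smooth_on V g) (hg : analytic_on V g)
    (H : 'rV[R]_n -> R)
    (hH : forall x, H x = g (x + z) - g z - dot (gradient g z) x)
    (hN : newton_polyhedron H !=set0)
    (hyT : ~ tangent_space S y y)
    (* cutoff supported in the region where S is the graph of g *)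
    (phi : 'rV[R]_n.+1 -> R) (hphi : smooth_on setT phi)
    (hphi_compact : compact (closure [set x | phi x != 0]))
    (hphi_U : closure [set x | phi x != 0] `<=` U)
    (hphi_ge0 : forall x, 0 <= phi x) (hphi_y : phi y != 0)
    (m : nat) (hm : max_face_zero_order H m)
    (hmd : Num.max (newton_distance H) 2 < m%:R)
    (a : nat -> 'rV[R]_n) (ha_axes : forall k, off_axes (a k))
    (ha : a k @[k --> \oo] --> (0 : 'rV[R]_n))
    (hform : forall k, exists (i : 'I_n) (W : set 'rV[R]_n)
       (xi : 'rV[R]_n -> R) (b : 'rV[R]_n.-1 -> R),
       [/\ open W /\ W (a k), W `<=` [set x | V (x + z)],
           analytic_on W xi /\ analytic_on (col' i @` W) b,
           xi (a k) != 0 /\ b (col' i (a k)) = a k 0 i &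
           forall x, W x -> H x = xi x * (x 0 i - b (col' i x)) ^+ m]) :
  forall p : R, 2 < p -> p <= m%:R ->
    ~ bounded_on_Lp p (maximal_operator S sigma phi).
Proof.
move=> p p2 pm.
have [rho [kappa [rho0 kappa0 low]]] := maximal_operator_test_fun_ge hsigma hU hV
  hVz hgraph hz hg_smooth hg hH hyT hphi hphi_U hphi_ge0 hphi_y ha hform pm.
have p1 : 1 < p by rewrite (lt_trans _ p2)// ltr1n.
apply: (not_bounded_on_Lp (f := test_fun (snoc (- gradient g z) 1) p)
  (D := p * 2 `^ p * Num.sqrt pi ^+ n.+1) p2 kappa0 rho0 _ _ _ low).
- by rewrite !mulr_ge0 ?powR_ge0 ?exprn_ge0 ?sqrtr_ge0// ltW// (lt_trans _ p2).
- by move=> N; exact/gaussian_span_schwartz/test_fun_span.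
- by move=> N; apply: Lnorm_test_fun_le => //; exact: snoc_max.
Qed.
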